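(* Let $P$ be a poset. The square $$\begin{array}{ccc}\mathbf{HoMod}_P&\hookrightarrow&\mathbf N_P\\ \downarrow&&\downarrow{\scriptstyle D^T}\\ \mathbf{Top}_P&\xrightarrow{\ \mathrm{HoLink}\ }&\mathrm{Fun}(\mathrm{sd}(P)^{\mathrm{op}},\mathbf{Top})\end{array}$$ whose left vertical functor is the forgetful functor $(\mathcal X,\mathfrak U_{\mathcal X})\mapsto\mathcal X$, commutes up to weak equivalence; that is, the functors $(\mathcal X,\mathfrak U_{\mathcal X})\mapsto\mathrm{HoLink}(\mathcal X)$ and $(\mathcal X,\mathfrak U_{\mathcal X})\mapsto D^T(\mathfrak U_{\mathcal X})$ from $\mathbf{HoMod}_P$ to $\mathrm{Fun}(\mathrm{sd}(P)^{\mathrm{op}},\mathbf{Top})$ are weakly equivalent (connected by a zigzag of natural transformations that are pointwise weak homotopy equivalences).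
   Context: $P$ is viewed as a topological space whose closed sets are the downward closed subsets. $\mathbf{Top}$ is a fixed one of: all topological spaces, compactly generated spaces, $\Delta$-generated spaces. A $P$-stratified space $\mathcal X=(X,s_X)$ is $X\in\mathbf{Top}$ with a continuous map $s_X\colon X\to P$; stratum-preserving maps are continuous maps over $P$; the category is $\mathbf{Top}_P$. Write $X_p=s_X^{-1}(p)$, $X_{\le p}=\{x\mid s_X(x)\le p\}$, $X_{\ge p}=\{x\mid s_X(x)\ge p\}$. A flag is a finite nonempty sequence $\mathcal J=[q_0\le\dots\le q_m]$ in $P$, regular if all inequalities are strict. $\mathrm{sd}(P)$ is the poset of regular flags under inclusion. $|\Delta^{\mathcal J}|_s$ is $|\Delta^m|$ with stratification $x\mapsto\max\{q_i\mid x_i>0\}$. For a regular flag $\mathcal I$, $\mathrm{HoLink}_{\mathcal I}(\mathcal X)$ is the set of stratum-preserving maps $|\Delta^{\mathcal I}|_s\to\mathcal X$ with the subspace topology (in $\mathbf{Top}$) of the compact-open topology. $\mathrm{HoLink}(\mathcal X)\in\mathrm{Fun}(\mathrm{sd}(P)^{\mathrm{op}},\mathbf{Top})$ is $\mathcal I\mapsto\mathrm{HoLink}_{\mathcal I}(\mathcal X)$ with structure maps restriction along $|\Delta^{\mathcal I'}|_s\subset|\Delta^{\mathcal I}|_s$ for $\mathcal I'\subset\mathcal I$. A $\Delta_P$-neighborhood of $S\subset X$ in $\mathcal X$ is a subset $U\subset X$ such that for every flag $\mathcal J$ and every stratum-preserving $\sigma\colon|\Delta^{\mathcal J}|_s\to\mathcal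 X$, $\sigma^{-1}(U)$ is a neighborhood of $\sigma^{-1}(S)$. A strata-neighborhood system of $\mathcal X$ is a family of subspaces $\mathfrak U_{\mathcal X}=(U_{\mathcal X}(p))_{p\in P}$ such that $U_{\mathcal X}(p)$ is a $\Delta_P$-neighborhood of $X_p$ and $X_{\le p}\subset U_{\mathcal X}(p)$. For a regular flag $\mathcal I$, $U_{\mathcal X}(\mathcal I)=\bigcap_{p\in\mathcal I}U_{\mathcal X}(p)$, written $\mathcal U_{\mathcal X}(\mathcal I)$ when equipped with the inherited stratification. $\mathbf N_P$ is the category of pairs $(\mathcal X,\mathfrak U_{\mathcal X})$, with morphisms $(\mathcal X,\mathfrak U_{\mathcal X})\to(\mathcal Y,\mathfrak U_{\mathcal Y})$ the stratum-preserving maps $f\colon\mathcal X\to\mathcal Y$ such that $f(U_{\mathcal X}(p))\subset U_{\mathcal Y}(p)$ for all $p$. The functor $D^T\colon\mathbf N_P\to\mathrm{Fun}(\mathrm{sd}(P)^{\mathrm{op}},\mathbf{Top})$ sends $(\mathcal X,\mathfrak U_{\mathcal X})$ to $\mathcal I=[p_0<\dots<p_n]\mapsto U_{\mathcal X}(\mathcal I)_{\ge p_n}$, with structure maps the inclusions. $\mathfrak U_{\mathcal X}$ is a homotopy link model for $\mathcal X$ if for each regular flag $\mathcal I=[p_0<\dots<p_n]$ the evaluation at the last vertex $\mathrm{HoLink}_{\mathcal I}(\mathcal U_{\mathcal X}(\mathcal I))\to U_{\mathcal X}(\mathcal I)_{p_n}$ and the inclusion $U_{\mathcal X}(\mathcal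 I)_{p_n}\hookrightarrow U_{\mathcal X}(\mathcal I)_{\ge p_n}$ are weak homotopy equivalences. $\mathbf{HoMod}_P\subset\mathbf N_P$ is the full subcategory of those pairs where $\mathfrak U_{\mathcal X}$ is a homotopy link model for $\mathcal X$. *)

(* Defs.v *)
From HB Require Import structures.
From mathcomp Require Import all_boot all_order all_algebra.
From mathcomp Require Import all_classical reals topology normedtype.

Set Implicit Arguments.
Unset Strict Implicit.
Unset Printing Implicit Defensive.

Import Order.TTheory GRing.Theory Num.Theory.
Import numFieldNormedType.Exports.

Local Open Scope classical_set_scope.
Local Open Scope ring_scope.

Record category := Category {
  obj :> Type;
  hom : obj -> obj -> Type;
  idm : forall A, hom A A;
  compm : forall A B C, hom B C -> hom A B -> hom A C;
  comp_idl : forall A B (f : hom A B), compm (idm B) f = f;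
  comp_idr : forall A B (f : hom A B), compm f (idm A) = f;
  comp_assoc : forall A B C D (h : hom C D) (g : hom B C) (f : hom A B),
    compm h (compm g f) = compm (compm h g) f }.
Arguments hom {_} _ _.
Arguments idm {_} _.
Arguments compm {_ _ _ _} _ _.

Record functor (C D : category) := Functor {
  fobj :> C -> D;
  fmap : forall A B : C, hom A B -> hom (fobj A) (fobj B);
  fmap_id : forall A : C, fmap (idm A) = idm (fobj A);
  fmap_comp : forall (A B E : C) (g : hom B E) (f : hom A B),
    fmap (compm g f) = compm (fmap g) (fmap f) }.
Arguments fmap {_ _} _ {_ _} _.

Record nat_trans (C D : category) (F G : functor C D) := NatTrans {
  component :> forall A : C, hom (F A) (G A);
  naturality : forall (A B : C) (f : hom A B),
    compm (component B) (fmap F f) = compm (fmap G f) (component A) }.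

Lemma nat_trans_eq (C D : category) (F G : functor C D) (s t : nat_trans F G) :
  (forall A, s A = t A) -> s = t.
Proof.
case: s t => [s sP] [t tP] /= st.
have ? : s = t by apply: functional_extensionality_dep.
by subst t; congr NatTrans; exact: Prop_irrelevance.
Qed.

Program Definition functor_category (C D : category) : category :=
  @Category (functor C D) (@nat_trans C D)
    (fun F => @NatTrans C D F F (fun A => idm (F A)) _)
    (fun F G H t s => @NatTrans C D F H (fun A => compm (t A) (s A)) _) _ _ _.
Next Obligation. by move=> * /=; rewrite comp_idl comp_idr. Qed.
Next Obligation. by move=> * /=; rewrite -comp_assoc naturality !comp_assoc naturality. Qed.
Next Obligation. by move=> *; apply: nat_trans_eq => A /=; rewrite comp_idl. Qed.
Next Obligation. by move=> *; apply: nat_trans_eq => A /=; rewrite comp_idr. Qed.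
Next Obligation. by move=> *; apply: nat_trans_eq => X /=; rewrite comp_assoc. Qed.

Program Definition opposite (C : category) : category :=
  @Category C (fun A B => @hom C B A) (fun A => idm A)
    (fun A B D g f => compm f g) _ _ _.
Next Obligation. by move=> * /=; rewrite comp_idr. Qed.
Next Obligation. by move=> * /=; rewrite comp_idl. Qed.
Next Obligation. by move=> * /=; rewrite comp_assoc. Qed.

Program Definition functor_comp (C D E : category)
    (G : functor D E) (F : functor C D) : functor C E :=
  @Functor C E (fun A => G (F A)) (fun A B f => fmap G (fmap F f)) _ _.
Next Obligation. by move=> * /=; rewrite !fmap_id. Qed.
Next Obligation. by move=> * /=; rewrite !fmap_comp. Qed.

Definition full_subcategory (C : category) (Q : C -> Prop) : category :=
  @Category {A : C | Q A} (fun A B => @hom C (sval A) (sval B))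
    (fun A => idm (sval A)) (fun A B D g f => compm g f)
    (fun A B f => comp_idl f) (fun A B f => comp_idr f)
    (fun A B D E h g f => comp_assoc h g f).

Definition full_inclusion (C : category) (Q : C -> Prop) :
    functor (full_subcategory Q) C :=
  @Functor (full_subcategory Q) C (fun A => sval A) (fun A B f => f)
    (fun A => erefl) (fun A B D g f => erefl).

Inductive zigzag (C : category) (W : forall A B : C, hom A B -> Prop) :
    C -> C -> Prop :=
| zigzag_refl A : zigzag W A A
| zigzag_forward A B E (w : hom A B) : W A B w -> zigzag W B E -> zigzag W A E
| zigzag_backward A B E (w : hom B A) : W B A w -> zigzag W B E -> zigzag W A E.

Definition std_simplex (R : realType) (n : nat) : set 'rV[R]_n.+1 :=
  [set x | (forall i, 0 <= x ord0 i) /\ \sum_i x ord0 i = 1].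
Arguments std_simplex : clear implicits.

Variant space_kind := AllSpaces | CompactlyGenerated | DeltaGenerated.

(* [CompactlyGenerated] spaces are k-spaces: the topology is the final one with
   respect to the continuous maps from compact Hausdorff spaces; no separation
   axiom is required of the space itself. *)
Definition test_open (R : realType) (k : space_kind) (X : topologicalType)
    (U : set X) : Prop :=
  match k with
  | AllSpaces => open U
  | CompactlyGenerated => forall K : topologicalType,
      compact [set: K] -> hausdorff_space K ->
      forall f : K -> X, continuous f -> open (f @^-1` U)
  | DeltaGenerated => forall n (f : std_simplex R n -> X),
      continuous f -> open (f @^-1` U)
  end.
Arguments test_open : clear implicits.
Arguments test_open _ _ {_} _.

(* X retopologized by its test-open sets: the coreflection of X into Top. *)
Definition coreflection (R : realType) (k : space_kind) (X : topologicalType) :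
  Type := X.
Arguments coreflection : clear implicits.

Section Coreflection.
Context (R : realType) (k : space_kind) (X : topologicalType).

Lemma test_openW (U : set X) : open U -> test_open R k U.
Proof.
case: k => //= oU; first by move=> K _ _ f /continuousP; exact.
by move=> n f /continuousP; exact.
Qed.

Local Lemma test_openT : test_open R k [set: X].
Proof. exact/test_openW/openT. Qed.

Local Lemma test_openI : setI_closed (@test_open R k X).
Proof.
case: k => /= A B; first exact: openI.
- by move=> oA oB K cK hK f cf; rewrite preimage_setI; apply: openI;
    [exact: oA|exact: oB].
- by move=> oA oB n f cf; rewrite preimage_setI; apply: openI;
    [exact: oA|exact: oB].
Qed.

Local Lemma test_open_bigU (I : Type) (f : I -> set X) :
  (forall i, test_open R k (f i)) -> test_open R k (\bigcup_i f i).
Proof.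
case: k => /= oF; first by apply: bigcup_open => i _; exact: oF.
- move=> K cK hK g cg; rewrite preimage_bigcup; apply: bigcup_open => i _.
  exact: oF.
- move=> n g cg; rewrite preimage_bigcup; apply: bigcup_open => i _; exact: oF.
Qed.

HB.instance Definition _ := Choice.on (coreflection R k X).
HB.instance Definition _ := isOpenTopological.Build (coreflection R k X)
  test_openT test_openI test_open_bigU.

Lemma coreflection_openE (U : set (coreflection R k X)) :
  open U = test_open R k (U : set X).
Proof. by []. Qed.

Lemma coreflection_id_continuous :
  continuous (id : coreflection R k X -> X).
Proof. by apply/continuousP => U oU; exact: test_openW. Qed.

End Coreflection.

Record space (R : realType) (k : space_kind) := Space {
  space_top :> topologicalType;
  spaceP : forall U : set space_top, test_open R k U -> open U }.
Arguments Space {R k} _ _.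

Section Spaces.
Context (R : realType) (k : space_kind).

Lemma test_open_comp (X Y : topologicalType) (f : X -> Y) (U : set Y) :
  continuous f -> test_open R k U -> test_open R k (f @^-1` U).
Proof.
move=> cf; case: k => /= oU; first by move/continuousP: cf => /(_ _ oU).
- move=> K cK hK g cg; apply: (oU K cK hK (f \o g)) => x.
  by apply: continuous_comp; [exact: cg|exact: cf].
- move=> n g cg; apply: (oU n (f \o g)) => x.
  by apply: continuous_comp; [exact: cg|exact: cf].
Qed.

Lemma continuous_to_coreflection (X : space R k) (Y : topologicalType)
    (f : X -> Y) : continuous f -> continuous (f : X -> coreflection R k Y).
Proof.
move=> cf; apply/continuousP => U oU; apply: spaceP; exact: (test_open_comp cf oU).
Qed.

Lemma coreflection_continuous (X Y : topologicalType) (f : X -> Y) :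
  continuous f ->
  continuous (f : coreflection R k X -> coreflection R k Y).
Proof.
by move=> cf; apply/continuousP => U; exact: (test_open_comp cf).
Qed.

Lemma coreflection_in (X : topologicalType) (U : set (coreflection R k X)) :
  test_open R k U -> open U.
Proof.
rewrite coreflection_openE; move: U; rewrite /coreflection.
case: k => /= U oU; first exact: oU.
- move=> K cK hK f cf; apply: oU => //.
  apply/continuousP => V; exact.
- move=> n f cf; apply: oU.
  apply/continuousP => V; exact.
Qed.

End Spaces.

Definition core_space (R : realType) (k : space_kind) (X : topologicalType) :
  space R k := Space (coreflection R k X) (@coreflection_in R k X).
Arguments core_space : clear implicits.

Program Definition top_category (R : realType) (k : space_kind) : category :=
  @Category (space R k) (fun X Y => continuousType X Y)
    (fun X => idfun : continuousType X X)
    (fun X Y Z g f => (g \o f : continuousType X Z)) _ _ _.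
Next Obligation. by move=> *; apply/continuousEP. Qed.
Next Obligation. by move=> *; apply/continuousEP. Qed.
Next Obligation. by move=> *; apply/continuousEP. Qed.

(* A is coerced to the subtype of its elements, with the subspace topology, which
   is then made an object of Top by coreflection. *)
Definition subspace_in (R : realType) (k : space_kind) (X : space R k)
  (A : set X) : space R k := core_space R k A.

Section Subspaces.
Context (R : realType) (k : space_kind).
Implicit Types X Y : space R k.

Definition subspace_val X (A : set X) (x : subspace_in A) : X :=
  \val (x : set_type A).

Lemma subspace_valP X (A : set X) (x : subspace_in A) : A (subspace_val x).
Proof. exact: set_valP. Qed.

Lemma subspace_val_inj X (A : set X) : injective (@subspace_val X A).
Proof. exact: val_inj. Qed.

Lemma subspace_val_continuous X (A : set X) : continuous (@subspace_val X A).
Proof.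
apply/continuousP => U oU; apply: test_openW.
have /continuousP := @initial_continuous (set_type A) X set_val; exact.
Qed.

Definition subspace_lift (T : Type) X (A : set X) (f : T -> X)
    (fA : forall t, A (f t)) (t : T) : subspace_in A :=
  exist (fun x => x \in A) (f t) (mem_set (fA t)).

Lemma subspace_lift_continuous (Y X : space R k) (A : set X) (f : Y -> X)
    (fA : forall t, A (f t)) :
  continuous f -> continuous (subspace_lift fA).
Proof.
move=> cf; apply: continuous_to_coreflection.
exact: (@continuous_comp_initial (set_type A) Y X set_val).
Qed.

Definition subspace_incl X (A : set X) : continuousType (subspace_in A) X :=
  mkcts (@subspace_val_continuous X A).

Section Restriction.
Context (X Y : space R k) (A : set X) (B : set Y) (f : continuousType X Y)
  (fAB : forall x, A x -> B (f x)).

Local Lemma restr_sub (x : subspace_in A) : B (f (subspace_val x)).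
Proof. exact: (fAB (subspace_valP x)). Qed.

Local Lemma restr_cont : continuous (f \o @subspace_val X A).
Proof.
move=> x; apply: continuous_comp; [exact: subspace_val_continuous|].
exact: cts_fun.
Qed.

Definition subspace_map : continuousType (subspace_in A) (subspace_in B) :=
  mkcts (subspace_lift_continuous (fA := restr_sub) restr_cont).

Lemma subspace_mapE x : subspace_val (subspace_map x) = f (subspace_val x).
Proof. by []. Qed.

End Restriction.
End Subspaces.

Definition alexandrov (d : Order.disp_t) (P : porderType d) : Type := P.

Section Alexandrov.
Context (d : Order.disp_t) (P : porderType d).

Definition upward_closed (U : set P) := forall p q, (p <= q)%O -> U p -> U q.

Local Lemma upT : upward_closed setT. Proof. by []. Qed.

Local Lemma upI : setI_closed upward_closed.
Proof.
by move=> A B uA uB p q pq [Ap Bp]; split; [exact: uA pq Ap|exact: uB pq Bp].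
Qed.

Local Lemma up_bigU (I : Type) (f : I -> set P) :
  (forall i, upward_closed (f i)) -> upward_closed (\bigcup_i f i).
Proof. by move=> uf p q pq [i _ fip]; exists i => //; exact: uf pq fip. Qed.

HB.instance Definition _ := Choice.on (alexandrov P).
HB.instance Definition _ :=
  isOpenTopological.Build (alexandrov P) upT upI up_bigU.

Lemma alexandrov_openE (U : set (alexandrov P)) : open U = upward_closed U.
Proof. by []. Qed.

Lemma alexandrov_closedP (A : set (alexandrov P)) :
  closed A <-> forall p q : P, (p <= q)%O -> A q -> A p.
Proof.
rewrite -openC alexandrov_openE; split=> [oA p q pq Aq|dA p q pq /= nAp Aq].
- by apply: contrapT => nAp; exact: (oA p q pq nAp Aq).
- by apply: nAp; exact: dA pq Aq.
Qed.

End Alexandrov.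

Record strat_space (R : realType) (k : space_kind) (d : Order.disp_t)
    (P : porderType d) := StratSpace {
  strat_top :> space R k;
  strat : strat_top -> P;
  strat_continuous : continuous (strat : strat_top -> alexandrov P) }.
Arguments strat {R k d P _} _.

Record strat_map (R : realType) (k : space_kind) (d : Order.disp_t)
    (P : porderType d) (X Y : strat_space R k P) := StratMap {
  strat_fun :> continuousType X Y;
  strat_funP : forall x, strat (strat_fun x) = strat x }.

Lemma strat_map_eq (R : realType) (k : space_kind) (d : Order.disp_t)
    (P : porderType d) (X Y : strat_space R k P) (f g : strat_map X Y) :
  f =1 g -> f = g.
Proof.
case: f g => [f fP] [g gP] /= /continuousEP fg; subst g.
by congr StratMap; exact: Prop_irrelevance.
Qed.

Program Definition strat_category (R : realType) (k : space_kind)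
    (d : Order.disp_t) (P : porderType d) : category :=
  @Category (strat_space R k P) (@strat_map R k d P)
    (fun X => @StratMap R k d P X X (idfun : continuousType X X) _)
    (fun X Y Z g f =>
       @StratMap R k d P X Z (g \o f : continuousType X Z) _) _ _ _.
Next Obligation. by []. Qed.
Next Obligation. by move=> * /=; rewrite !strat_funP. Qed.
Next Obligation. by move=> *; apply: strat_map_eq. Qed.
Next Obligation. by move=> *; apply: strat_map_eq. Qed.
Next Obligation. by move=> *; apply: strat_map_eq. Qed.

Section Strata.
Context (R : realType) (k : space_kind) (d : Order.disp_t) (P : porderType d).
Implicit Types X Y : strat_space R k P.

Local Lemma substrat_continuous X (A : set X) :
  continuous (strat \o @subspace_val R k X A : subspace_in A -> alexandrov P).
Proof.
move=> x; apply: continuous_comp; [exact: subspace_val_continuous|].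
exact: strat_continuous.
Qed.

Definition substrat X (A : set X) : strat_space R k P :=
  StratSpace (@substrat_continuous X A).

Definition stratum_eq X (p : P) : set X := [set x | strat x = p].
Definition stratum_le X (p : P) : set X := [set x | (strat x <= p)%O].
Definition stratum_ge X (p : P) : set X := [set x | (p <= strat x)%O].

End Strata.
Arguments stratum_eq {R k d P} X p.
Arguments stratum_le {R k d P} X p.
Arguments stratum_ge {R k d P} X p.

(* The flag q_0 <= ... <= q_m is stored as the pair of q_0 and [:: q_1; ..; q_m]. *)
Record flag (d : Order.disp_t) (P : porderType d) := Flag {
  flag_head : P;
  flag_tail : seq P;
  flagP : path <=%O flag_head flag_tail }.

Definition flag_seq (d : Order.disp_t) (P : porderType d) (J : flag P) : seq P :=
  flag_head J :: flag_tail J.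
Coercion flag_seq : flag >-> seq.

Record regular_flag (d : Order.disp_t) (P : porderType d) := RegularFlag {
  regular_flag_val :> flag P;
  regular_flagP : sorted <%O regular_flag_val }.

Section Flags.
Context (d : Order.disp_t) (P : porderType d).
Implicit Types (J : flag P) (I : regular_flag P).

Definition flag_dim J : nat := size (flag_tail J).
Definition flag_vertex J (i : 'I_(flag_dim J).+1) : P := nth (flag_head J) J i.
Definition flag_last J : P := last (flag_head J) (flag_tail J).

Lemma flag_vertex_le J (i j : 'I_(flag_dim J).+1) :
  (i <= j)%N -> (flag_vertex i <= flag_vertex j)%O.
Proof.
move=> ij; have sJ : sorted <=%O J by exact: flagP.
by apply: (sorted_leq_nth le_trans lexx (flag_head J) sJ) => //; rewrite inE /=.
Qed.

Lemma flag_vertex_mem J (i : 'I_(flag_dim J).+1) : flag_vertex i \in (J : seq P).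
Proof. exact: mem_nth. Qed.

Lemma flag_mem_vertex J p : p \in (J : seq P) ->
  exists i : 'I_(flag_dim J).+1, flag_vertex i = p.
Proof.
move=> pJ; have iJ : (index p J < (flag_dim J).+1)%N by rewrite index_mem.
by exists (Ordinal iJ); rewrite /flag_vertex /= nth_index.
Qed.

Lemma flag_vertex_max J : flag_vertex (ord_max : 'I_(flag_dim J).+1) = flag_last J.
Proof. by rewrite /flag_vertex /flag_last /= (last_nth (flag_head J)). Qed.

Lemma flag_last_mem J : flag_last J \in (J : seq P).
Proof. by rewrite -flag_vertex_max flag_vertex_mem. Qed.

Lemma flag_last_ge J p : p \in (J : seq P) -> (p <= flag_last J)%O.
Proof.
move=> /flag_mem_vertex[i <-]; rewrite -flag_vertex_max.
by apply: flag_vertex_le; rewrite -ltnS.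
Qed.

Lemma flag_vertex_inj I : injective (@flag_vertex I).
Proof.
move=> i j /eqP; rewrite nth_uniq//; first by move=> /eqP/val_inj.
exact: (lt_sorted_uniq (regular_flagP I)).
Qed.

End Flags.

(* sd(P): a morphism from I' to I is an inclusion of flags, seen as sets. *)
Definition flag_incl (d : Order.disp_t) (P : porderType d)
  (I' I : regular_flag P) : Prop := {subset (I' : seq P) <= (I : seq P)}.

Program Definition sd_category (d : Order.disp_t) (P : porderType d) : category :=
  @Category (regular_flag P) (@flag_incl d P) _ _ _ _ _.
Next Obligation. by move=> d P I. Qed.
Next Obligation. by move=> d P I J K JK IJ p pI; exact/JK/IJ. Qed.
Next Obligation. by move=> *; exact: Prop_irrelevance. Qed.
Next Obligation. by move=> *; exact: Prop_irrelevance. Qed.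
Next Obligation. by move=> *; exact: Prop_irrelevance. Qed.

Definition simplex (R : realType) (d : Order.disp_t) (P : porderType d)
  (J : flag P) : set 'rV[R]_(flag_dim J).+1 := std_simplex R (flag_dim J).
Arguments simplex R {d P} J.

Definition barycentric (R : realType) (d : Order.disp_t) (P : porderType d)
    (J : flag P) (x : simplex R J) (i : 'I_(flag_dim J).+1) : R :=
  (\val x : 'rV[R]_(flag_dim J).+1) ord0 i.

(* The vertices of a flag form a chain with least element the head, so that the
   iterated maximum, started at the head, is max {q_i | x_i > 0}. *)
Definition simplex_strat (R : realType) (d : Order.disp_t) (P : porderType d)
    (J : flag P) (x : simplex R J) : P :=
  \big[Order.max/flag_head J]_(i | 0 < barycentric x i) flag_vertex i.

Section Simplices.
Context (R : realType) (d : Order.disp_t) (P : porderType d).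
Implicit Types (J : flag P).

Lemma barycentricP J (x : simplex R J) :
  (forall i, 0 <= barycentric x i) /\ \sum_i barycentric x i = 1.
Proof. exact: (set_valP x). Qed.

Lemma barycentric_ge0 J (x : simplex R J) i : 0 <= barycentric x i.
Proof. by have [] := barycentricP x. Qed.

Lemma barycentric_sum J (x : simplex R J) : \sum_i barycentric x i = 1.
Proof. by have [] := barycentricP x. Qed.

Lemma barycentric_inj J (x y : simplex R J) :
  barycentric x =1 barycentric y -> x = y.
Proof.
by move=> xy; apply: val_inj; apply/rowP => i; exact: xy.
Qed.

Lemma barycentric_supp J (x : simplex R J) : exists i, 0 < barycentric x i.
Proof.
apply: contrapT => /forallNP x0; have := barycentric_sum x.
rewrite big1 => [/esym/eqP|i _]; first by rewrite oner_eq0.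
have [//|xi] := eqVneq (barycentric x i) 0.
by case: (x0 i); rewrite lt0r xi barycentric_ge0.
Qed.

Lemma barycentric_continuous J (i : 'I_(flag_dim J).+1) :
  continuous ((@barycentric R d P J)^~ i).
Proof.
move=> x; apply: (@continuous_comp _ _ _ (set_val : simplex R J -> _)
  (fun M : 'rV[R]_(flag_dim J).+1 => M ord0 i)).
  exact: (@initial_continuous (simplex R J) _ set_val x).
exact: coord_continuous.
Qed.

Lemma simplex_stratP J (x : simplex R J) (p : P) :
  simplex_strat x = p <->
  (exists2 i, 0 < barycentric x i & flag_vertex i = p) /\
  (forall i, 0 < barycentric x i -> (flag_vertex i <= p)%O).
Proof.
have cJ (a b : P) : a \in (J : seq P) -> b \in (J : seq P) -> (a >=< b)%O.
  move=> /flag_mem_vertex[i <-] /flag_mem_vertex[j <-].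
  rewrite /Order.comparable; case/orP: (leq_total i j) => /flag_vertex_le -> //.
  by rewrite orbT.
pose v := @flag_vertex d P J; pose Q i := 0 < barycentric x i.
have hv i : (flag_head J <= v i)%O by apply: (@flag_vertex_le _ _ J ord0 i).
have rec (s : seq 'I_(flag_dim J).+1) :
    let r := \big[Order.max/flag_head J]_(i <- s | Q i) v i in
    [/\ r \in (J : seq P), r = flag_head J \/ (exists2 i, Q i & v i = r),
        (flag_head J <= r)%O & forall i, i \in s -> Q i -> (v i <= r)%O].
  elim: s => [|i s [rJ rE hr rmax]] /=.
    by rewrite big_nil; split => //; [rewrite inE eqxx|left].
  rewrite big_cons; case: ifPn => [Qi|nQi]; last first.
    split => // j; rewrite inE => /predU1P[->|]; first by rewrite (negbTE nQi).
    exact: rmax.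
  set r := \big[_/_]_(_ <- s | _) _ in rJ rE hr rmax *.
  rewrite maxElt; case: ifPn => [ir|].
    split => // j; rewrite inE => /predU1P[-> _|]; [exact: ltW|exact: rmax].
  rewrite comparable_ltNge; last by apply: cJ => //; exact: flag_vertex_mem.
  rewrite negbK => ri; split => //; first exact: flag_vertex_mem.
  - by right; exists i.
  - move=> j; rewrite inE => /predU1P[->//|js Qj].
    exact: le_trans (rmax _ js Qj) ri.
have {rec} [_ rE hr rmax] := rec (index_enum _).
have sE : (exists2 i, Q i & v i = simplex_strat x) /\
    (forall i, Q i -> (v i <= simplex_strat x)%O).
  split=> [|i Qi]; last exact: rmax (mem_index_enum i) Qi.
  case: rE => // rh; have [i Qi] := barycentric_supp x; exists i => //.
  apply/eqP; rewrite eq_le rmax ?mem_index_enum//=.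
  by rewrite /simplex_strat rh; exact: hv.
split=> [<- //|[[i Qi <-] max_i]].
have [[j Qj jE] max_j] := sE.
by apply/le_anti; rewrite (max_j _ Qi) -jE (max_i _ Qj).
Qed.

Lemma cvg_sum_fun (T I : Type) (F : set_system T) (FF : Filter F)
    (s : seq I) (Q : pred I) (f : I -> T -> R) (l : I -> R) :
  (forall i, Q i -> f i @ F --> l i) ->
  (fun t => \sum_(i <- s | Q i) f i t) @ F --> \sum_(i <- s | Q i) l i.
Proof.
move=> fl; elim: s => [|i s IH].
  by under eq_fun do rewrite big_nil; rewrite big_nil; exact: cvg_cst.
rewrite big_cons; under eq_fun do rewrite big_cons.
by case: ifP => // Qi; apply: cvgD => //; exact: fl.
Qed.

Section Face.
Context (I' I : regular_flag P) (sub : flag_incl I' I).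

Definition face_row (x : simplex R I') : 'rV[R]_(flag_dim I).+1 :=
  \row_j \sum_(i | flag_vertex i == flag_vertex j) barycentric x i.

Lemma face_row_in x : simplex R I (face_row x).
Proof.
split=> [j|]; first by rewrite mxE sumr_ge0 // => i _; exact: barycentric_ge0.
rewrite -(barycentric_sum x).
under eq_bigr do rewrite mxE.
rewrite (exchange_big_dep xpredT)//=; apply: eq_bigr => i _.
have [j jE] := flag_mem_vertex (sub (flag_vertex_mem i)).
rewrite (big_pred1 j) // => l /=; rewrite -jE.
by apply/eqP/eqP => [/flag_vertex_inj|->].
Qed.

(* The inclusion of |Delta^I'| as the face of |Delta^I| spanned by I'. *)
Definition face (x : simplex R I') : simplex R I :=
  exist (fun y => y \in simplex R I) (face_row x) (mem_set (face_row_in x)).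

Lemma barycentric_face x j : barycentric (face x) j =
  \sum_(i | flag_vertex i == flag_vertex j) barycentric x i.
Proof. by rewrite /barycentric /= mxE. Qed.

Lemma face_strat x : simplex_strat (face x) = simplex_strat x.
Proof.
have suppE j : 0 < barycentric (face x) j <->
    exists2 i, 0 < barycentric x i & flag_vertex i = flag_vertex j.
  rewrite barycentric_face; split=> [|[i xi ij]].
    move=> s0; apply: contrapT => /forall2NP nx.
    suff s00 : \sum_(i | flag_vertex i == flag_vertex j) barycentric x i = 0.
      by rewrite s00 ltxx in s0.
    apply: big1 => i /eqP ij; have [//|xi0] := eqVneq (barycentric x i) 0.
    by have [] := nx i; rewrite ?lt0r ?xi0 ?barycentric_ge0.
  rewrite (bigD1 i) ?ij ?eqxx//= ltr_wpDr// sumr_ge0 // => l _.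
  exact: barycentric_ge0.
apply/simplex_stratP.
have [[i xi iE] imax] := (simplex_stratP x _).1 erefl.
split.
  have [j jE] := flag_mem_vertex (sub (flag_vertex_mem i)).
  by exists j; [apply/suppE; exists i|rewrite jE].
by move=> j /suppE[l xl <-]; exact: imax.
Qed.

Lemma face_continuous : continuous face.
Proof.
have cj j : continuous (fun y => barycentric (face y) j).
  under eq_fun do rewrite barycentric_face.
  by move=> x; apply: (cvg_sum_fun (nbhs_filter x)) => i _; exact: barycentric_continuous.
apply: (@continuous_comp_initial (simplex R I) _ _ set_val) => x U [V Vx VU].
have : \forall y \near x, forall j, V ord0 j (barycentric (face y) j).
  apply: (@filter_forall _ _ _ (nbhs x) (nbhs_filter x)) => j.
  by apply: cj; exact: Vx.
apply: filterS => y Vy; apply: VU => i j; rewrite ord1; exact: Vy.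
Qed.

End Face.

Lemma face_id (I : regular_flag P) (sub : flag_incl I I) x : face sub x = x.
Proof.
apply: barycentric_inj => j; rewrite barycentric_face (big_pred1 j) // => i /=.
by apply/eqP/eqP => [/flag_vertex_inj|->].
Qed.

Lemma face_comp (I1 I2 I3 : regular_flag P) (s12 : flag_incl I1 I2)
    (s23 : flag_incl I2 I3) (s13 : flag_incl I1 I3) x :
  face s13 x = face s23 (face s12 x).
Proof.
apply: barycentric_inj => j; rewrite !barycentric_face.
under [RHS]eq_bigr do rewrite barycentric_face.
rewrite (exchange_big_dep (fun i => flag_vertex i == flag_vertex j))/=.
  apply: eq_bigr => i /eqP ij.
  have [l lE] := flag_mem_vertex (s12 _ (flag_vertex_mem i)).
  rewrite (big_pred1 l) // => m /=; rewrite -lE.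
  apply/andP/eqP => [[_ /eqP/flag_vertex_inj ->]//|->].
  by rewrite lE ij.
by move=> l i /eqP lj /eqP ->; rewrite lj.
Qed.

Definition last_vertex J : simplex R J.
Proof.
exists (delta_mx ord0 ord_max); apply: mem_set; split=> [i|].
  by rewrite mxE ler0n.
rewrite (bigD1 ord_max)//= mxE !eqxx big1 ?addr0// => i /negbTE ni.
by rewrite mxE ni andbF.
Defined.

Lemma last_vertex_strat J : simplex_strat (last_vertex J) = flag_last J.
Proof.
have e i : barycentric (last_vertex J) i = (i == ord_max)%:R.
  by rewrite /barycentric /= mxE eqxx.
apply/simplex_stratP; split.
  by exists ord_max; [rewrite e eqxx|rewrite flag_vertex_max].
by move=> i _; exact/flag_last_ge/flag_vertex_mem.
Qed.

End Simplices.

Definition simplex_map (R : realType) (k : space_kind) (d : Order.disp_t)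
    (P : porderType d) (J : flag P) (X : strat_space R k P)
    (s : simplex R J -> X) : Prop :=
  continuous s /\ forall x, strat (s x) = simplex_strat x.

Definition simplex_maps (R : realType) (k : space_kind) (d : Order.disp_t)
    (P : porderType d) (J : flag P) (X : strat_space R k P) :
    set {compact-open, simplex R J -> X} :=
  [set s | simplex_map s].
Arguments simplex_maps {R k d P} J X.

Definition holink (R : realType) (k : space_kind) (d : Order.disp_t)
    (P : porderType d) (I : regular_flag P) (X : strat_space R k P) : space R k :=
  core_space R k (simplex_maps I X).

Section HoLink.
Context (R : realType) (k : space_kind) (d : Order.disp_t) (P : porderType d).
Implicit Types (X Y : strat_space R k P) (I : regular_flag P).

Definition holink_map I X (s : holink I X) : simplex R I -> X :=
  \val (s : set_type (simplex_maps I X)).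

Lemma holink_mapP I X (s : holink I X) : simplex_map (holink_map s).
Proof. exact: (set_valP s). Qed.

Lemma holink_map_inj I X : injective (@holink_map I X).
Proof. exact: val_inj. Qed.

Definition mk_holink I X (s : simplex R I -> X) (sP : simplex_map s) :
    holink I X :=
  exist (fun s => s \in simplex_maps I X) s (mem_set sP).

Lemma holink_map_continuous I X :
  continuous (@holink_map I X : _ -> {compact-open, simplex R I -> X}).
Proof.
apply/continuousP => U oU; apply: test_openW.
have /continuousP := @initial_continuous (simplex_maps I X) _ set_val; exact.
Qed.

Lemma mk_holink_continuous I X (Z : space R k) (f : Z -> simplex R I -> X)
    (fP : forall z, simplex_map (f z)) :
  continuous (f : Z -> {compact-open, simplex R I -> X}) ->
  continuous (fun z => mk_holink (fP z)).
Proof.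
move=> cf; apply: continuous_to_coreflection.
exact: (@continuous_comp_initial (simplex_maps I X) Z _ set_val).
Qed.

Section Restriction.
Context (I' I : regular_flag P) (sub : flag_incl I' I) (X : strat_space R k P).

Local Lemma restrict_map (s : holink I X) :
  simplex_map (holink_map s \o face sub).
Proof.
have [cs ss] := holink_mapP s; split=> [x|x]; last by rewrite /= ss face_strat.
by apply: continuous_comp; [exact: face_continuous|exact: cs].
Qed.

Local Lemma restrict_continuous :
  continuous (fun s : holink I X => mk_holink (restrict_map s)).
Proof.
apply: mk_holink_continuous => s; have FF := nbhs_filter s.
apply/compact_open_cvgP => K O cK oO sKO.
have cfK : compact (face sub @` K).
  apply: continuous_compact => //.
  exact/continuous_subspaceT/face_continuous.
have oKO := compact_open_open cfK oO.
have : nbhs s (@holink_map I X @^-1` [set g | g @` (face sub @` K) `<=` O]).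
  apply: holink_map_continuous; apply: open_nbhs_nbhs; split => //=.
  by move=> _ [_ [x Kx <-] <-]; apply: sKO; exists x.
apply: filterS => t tKO /= _ [x Kx <-]; apply: tKO.
by exists (face sub x) => //; exists x.
Qed.

Definition holink_restr : continuousType (holink I X) (holink I' X) :=
  mkcts restrict_continuous.

Lemma holink_restrE s x :
  holink_map (holink_restr s) x = holink_map s (face sub x).
Proof. by []. Qed.

End Restriction.

Section Functoriality.
Context (I : regular_flag P) (X Y : strat_space R k P) (f : strat_map X Y).

Local Lemma post_map (s : holink I X) : simplex_map (f \o holink_map s).
Proof.
have [cs ss] := holink_mapP s; split=> [x|x]; last by rewrite /= strat_funP ss.
by apply: continuous_comp; [exact: cs|exact: cts_fun].
Qed.

Local Lemma post_continuous :
  continuous (fun s : holink I X => mk_holink (post_map s)).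
Proof.
apply: mk_holink_continuous => s; have FF := nbhs_filter s.
apply/compact_open_cvgP => K O cK oO sKO.
have ofO : open (f @^-1` O) by have /continuousP := @cts_fun _ _ f; exact.
have oKO := compact_open_open cK ofO.
have : nbhs s (@holink_map I X @^-1` [set g | g @` K `<=` f @^-1` O]).
  apply: holink_map_continuous; apply: open_nbhs_nbhs; split => //=.
  by move=> _ [x Kx <-] /=; apply: sKO; exists x.
by apply: filterS => t tKO /= _ [x Kx <-]; apply: tKO; exists x.
Qed.

Definition holink_post : continuousType (holink I X) (holink I Y) :=
  mkcts post_continuous.

Lemma holink_postE s x : holink_map (holink_post s) x = f (holink_map s x).
Proof. by []. Qed.

End Functoriality.

Section EvalLast.
Context (I : regular_flag P) (X : strat_space R k P).

Local Lemma eval_last_in (s : holink I X) :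
  stratum_eq X (flag_last I) (holink_map s (last_vertex R I)).
Proof. by rewrite /stratum_eq /= (holink_mapP s).2 last_vertex_strat. Qed.

Local Lemma eval_last_continuous :
  continuous (fun s : holink I X => holink_map s (last_vertex R I)).
Proof.
apply/continuousP => O oO.
have /continuousP := @holink_map_continuous I X.
move=> /(_ _ (compact_open_open (@compact_set1 _ (last_vertex R I)) oO)).
congr open; apply/seteqP; split=> s /=; last by move=> sO _ [_ -> <-].
by apply; exists (last_vertex R I).
Qed.

Definition eval_last :
    continuousType (holink I X) (subspace_in (stratum_eq X (flag_last I))) :=
  mkcts (subspace_lift_continuous (fA := eval_last_in) eval_last_continuous).

End EvalLast.
End HoLink.

Definition diagram_category (R : realType) (k : space_kind)
    (d : Order.disp_t) (P : porderType d) : category :=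
  functor_category (opposite (sd_category P)) (top_category R k).
Arguments diagram_category R k {d} P.

Section HoLinkFunctor.
Context (R : realType) (k : space_kind) (d : Order.disp_t) (P : porderType d).

Program Definition holink_diagram (X : strat_category R k P) : diagram_category R k P :=
  @Functor (opposite (sd_category P)) (top_category R k)
    (fun I => holink I X) (fun I I' sub => holink_restr sub X) _ _.
Next Obligation.
move=> X I; apply/continuousEP => s; apply: holink_map_inj.
by apply/funext => x; rewrite holink_restrE face_id.
Qed.
Next Obligation.
move=> X I I' I'' sub' sub; apply/continuousEP => s; apply: holink_map_inj.
by apply/funext => x; rewrite !holink_restrE (face_comp sub' sub).
Qed.

Program Definition holink_functor :
    functor (strat_category R k P) (diagram_category R k P) :=
  @Functor (strat_category R k P) (diagram_category R k P) holink_diagram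
    (fun X Y f => @NatTrans _ _ (holink_diagram X) (holink_diagram Y)
       (fun I => holink_post I f) _) _ _.
Next Obligation.
by move=> *; apply/continuousEP => s; apply: holink_map_inj; apply/funext.
Qed.
Next Obligation.
move=> *; apply: nat_trans_eq => I; apply/continuousEP => s.
by apply: holink_map_inj; apply/funext.
Qed.
Next Obligation.
move=> *; apply: nat_trans_eq => I; apply/continuousEP => s.
by apply: holink_map_inj; apply/funext.
Qed.

End HoLinkFunctor.

Definition Delta_neighborhood (R : realType) (k : space_kind)
    (d : Order.disp_t) (P : porderType d) (X : strat_space R k P)
    (S U : set X) : Prop :=
  forall (J : flag P) (s : simplex R J -> X), simplex_map s ->
    set_nbhs (s @^-1` S) (s @^-1` U).

Record nbhd_space (R : realType) (k : space_kind) (d : Order.disp_t)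
    (P : porderType d) := NbhdSpace {
  nbhd_strat :> strat_space R k P;
  nbhd : P -> set nbhd_strat;
  nbhd_Delta : forall p,
    Delta_neighborhood (stratum_eq nbhd_strat p) (nbhd p);
  nbhd_le : forall p, stratum_le nbhd_strat p `<=` nbhd p }.
Arguments nbhd {R k d P} _ _.

Record nbhd_map (R : realType) (k : space_kind) (d : Order.disp_t)
    (P : porderType d) (X Y : nbhd_space R k P) := NbhdMap {
  nbhd_fun :> strat_map X Y;
  nbhd_funP : forall p x, nbhd X p x -> nbhd Y p (nbhd_fun x) }.

Lemma nbhd_map_eq (R : realType) (k : space_kind) (d : Order.disp_t)
    (P : porderType d) (X Y : nbhd_space R k P) (f g : nbhd_map X Y) :
  nbhd_fun f = nbhd_fun g -> f = g.
Proof.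
case: f g => [f fP] [g gP] /= fg; subst g.
by congr NbhdMap; exact: Prop_irrelevance.
Qed.

Program Definition nbhd_category (R : realType) (k : space_kind)
    (d : Order.disp_t) (P : porderType d) : category :=
  @Category (nbhd_space R k P) (@nbhd_map R k d P)
    (fun X => @NbhdMap R k d P X X (@idm (strat_category R k P) X) _)
    (fun X Y Z g f => @NbhdMap R k d P X Z
       (@compm (strat_category R k P) X Y Z g f) _) _ _ _.
Next Obligation. by []. Qed.
Next Obligation. by move=> * /=; do 2 apply: nbhd_funP. Qed.
Next Obligation. by move=> *; apply/nbhd_map_eq/strat_map_eq. Qed.
Next Obligation. by move=> *; apply/nbhd_map_eq/strat_map_eq. Qed.
Next Obligation. by move=> *; apply/nbhd_map_eq/strat_map_eq. Qed.

Program Definition forget_nbhd (R : realType) (k : space_kind)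
    (d : Order.disp_t) (P : porderType d) :
    functor (nbhd_category R k P) (strat_category R k P) :=
  @Functor (nbhd_category R k P) (strat_category R k P)
    (fun X => nbhd_strat X) (fun X Y f => nbhd_fun f) _ _.
Next Obligation. by []. Qed.
Next Obligation. by []. Qed.

Section NbhdDiagram.
Context (R : realType) (k : space_kind) (d : Order.disp_t) (P : porderType d).

Definition nbhd_flag_set (X : nbhd_space R k P) (I : regular_flag P) : set X :=
  \bigcap_(p in [set` (I : seq P)]) nbhd X p.
Arguments nbhd_flag_set X I : clear implicits.

Definition nbhd_flag (X : nbhd_space R k P) (I : regular_flag P) :
  strat_space R k P := substrat (nbhd_flag_set X I).

Definition nbhd_flag_ge (X : nbhd_space R k P) (I : regular_flag P) :
  space R k := subspace_in (stratum_ge (nbhd_flag X I) (flag_last I)).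

Definition nbhd_flag_eq (X : nbhd_space R k P) (I : regular_flag P) :
  space R k := subspace_in (stratum_eq (nbhd_flag X I) (flag_last I)).

Definition nbhd_flag_pt (X : nbhd_space R k P) (I : regular_flag P)
  (x : nbhd_flag_ge X I) : X := subspace_val (subspace_val x).

Lemma nbhd_flag_pt_inj X I : injective (@nbhd_flag_pt X I).
Proof. by move=> x y /subspace_val_inj/subspace_val_inj. Qed.

Lemma nbhd_flag_map_sub (X Y : nbhd_space R k P) (I I' : regular_flag P)
    (sub : flag_incl I' I) (f : nbhd_map X Y) x :
  nbhd_flag_set X I x -> nbhd_flag_set Y I' (f x).
Proof. by move=> xI p pI' /=; apply/nbhd_funP/xI/sub. Qed.

Definition nbhd_flag_map (X Y : nbhd_space R k P) (I I' : regular_flag P)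
    (sub : flag_incl I' I) (f : nbhd_map X Y) :
    continuousType (nbhd_flag X I) (nbhd_flag Y I') :=
  subspace_map (@nbhd_flag_map_sub X Y I I' sub f).

Lemma nbhd_flag_ge_map_sub (X Y : nbhd_space R k P) (I I' : regular_flag P)
    (sub : flag_incl I' I) (f : nbhd_map X Y) x :
  stratum_ge (nbhd_flag X I) (flag_last I) x ->
  stratum_ge (nbhd_flag Y I') (flag_last I') (nbhd_flag_map sub f x).
Proof.
rewrite /stratum_ge /= strat_funP; apply: le_trans.
exact/flag_last_ge/sub/flag_last_mem.
Qed.

Definition nbhd_flag_ge_map (X Y : nbhd_space R k P) (I I' : regular_flag P)
    (sub : flag_incl I' I) (f : nbhd_map X Y) :
    continuousType (nbhd_flag_ge X I) (nbhd_flag_ge Y I') :=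
  subspace_map (@nbhd_flag_ge_map_sub X Y I I' sub f).

Lemma nbhd_flag_ge_mapE X Y I I' (sub : flag_incl I' I) (f : nbhd_map X Y) x :
  nbhd_flag_pt (nbhd_flag_ge_map sub f x) = f (nbhd_flag_pt x).
Proof. by []. Qed.

Program Definition DT_diagram (X : nbhd_category R k P) : diagram_category R k P :=
  @Functor (opposite (sd_category P)) (top_category R k)
    (fun I => nbhd_flag_ge X I)
    (fun I I' sub => nbhd_flag_ge_map sub (idm X)) _ _.
Next Obligation.
by move=> *; apply/continuousEP => x; apply: nbhd_flag_pt_inj.
Qed.
Next Obligation.
by move=> *; apply/continuousEP => x; apply: nbhd_flag_pt_inj.
Qed.

Program Definition DT_functor :
    functor (nbhd_category R k P) (diagram_category R k P) :=
  @Functor (nbhd_category R k P) (diagram_category R k P) DT_diagram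
    (fun X Y f => @NatTrans _ _ (DT_diagram X) (DT_diagram Y)
       (fun I => nbhd_flag_ge_map (fun p pI => pI) f) _) _ _.
Next Obligation.
by move=> *; apply/continuousEP => x; apply: nbhd_flag_pt_inj.
Qed.
Next Obligation.
move=> *; apply: nat_trans_eq => I; apply/continuousEP => x.
exact: nbhd_flag_pt_inj.
Qed.
Next Obligation.
move=> *; apply: nat_trans_eq => I; apply/continuousEP => x.
exact: nbhd_flag_pt_inj.
Qed.

Lemma nbhd_flag_eq_ge (X : nbhd_space R k P) (I : regular_flag P) x :
  stratum_eq (nbhd_flag X I) (flag_last I) x ->
  stratum_ge (nbhd_flag X I) (flag_last I) x.
Proof. by rewrite /stratum_eq /stratum_ge /= => ->. Qed.

Definition nbhd_flag_incl (X : nbhd_space R k P) (I : regular_flag P) :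
    continuousType (nbhd_flag_eq X I) (nbhd_flag_ge X I) :=
  subspace_map (f := idfun) (@nbhd_flag_eq_ge X I).

End NbhdDiagram.

Section HomotopyGroups.
Context (R : realType).

Definition unit_itv : set R := [set t | 0 <= t <= 1].

Definition cube (n : nat) : set 'rV[R]_n :=
  [set c | forall i, 0 <= c ord0 i <= 1].
Arguments cube n : clear implicits.

Definition cube_boundary n : set (cube n) :=
  [set c | exists i, (\val c : 'rV[R]_n) ord0 i = 0 \/
                     (\val c : 'rV[R]_n) ord0 i = 1].

Definition spheroid n (X : topologicalType) (x0 : X) : set (cube n -> X) :=
  [set f | continuous f /\ forall c, cube_boundary c -> f c = x0].

Definition homotopic_rel n (X : topologicalType) (x0 : X)
    (f g : cube n -> X) : Prop :=
  exists H : unit_itv * cube n -> X,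
    [/\ continuous H,
        forall t c, \val t = 0 -> H (t, c) = f c,
        forall t c, \val t = 1 -> H (t, c) = g c &
        forall t c, cube_boundary c -> H (t, c) = x0].

(* The underlying set of the n-th homotopy group, a homotopy class being the set
   of its representatives. For n > 0 the induced map is a homomorphism, so that
   it is an isomorphism if and only if it is a bijection. *)
Definition homotopy_group n (X : topologicalType) (x0 : X) :
    set (set (cube n -> X)) :=
  [set homotopic_rel x0 f | f in spheroid x0].
Arguments homotopy_group n {X} x0.

Definition homotopy_group_map n (X Y : topologicalType) (f : X -> Y) (x0 : X)
    (C : set (cube n -> X)) : set (cube n -> Y) :=
  [set h | exists2 g, C g & homotopic_rel (f x0) (f \o g) h].

Definition joined (X : topologicalType) (x y : X) : Prop :=
  exists g : unit_itv -> X,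
    [/\ continuous g, forall t, \val t = 0 -> g t = x
                    & forall t, \val t = 1 -> g t = y].

Definition path_components (X : topologicalType) : set (set X) :=
  range (@joined X).
Arguments path_components X : clear implicits.

Definition path_components_map (X Y : topologicalType) (f : X -> Y)
    (C : set X) : set Y :=
  [set y | exists2 x, C x & joined (f x) y].

Definition weak_equivalence (X Y : topologicalType) (f : continuousType X Y) :
    Prop :=
  set_bij (path_components X) (path_components Y) (path_components_map f) /\
  forall n (x0 : X),
    set_bij (homotopy_group n.+1 x0) (homotopy_group n.+1 (f x0))
      (homotopy_group_map f x0).

End HomotopyGroups.

Section HoMod.
Context (R : realType) (k : space_kind) (d : Order.disp_t) (P : porderType d).

Definition holink_model (X : nbhd_space R k P) : Prop :=
  forall I : regular_flag P,
    weak_equivalence R (eval_last I (nbhd_flag X I)) /\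
    weak_equivalence R (nbhd_flag_incl X I).

Definition homod_category : category :=
  @full_subcategory (nbhd_category R k P) holink_model.

Definition homod_incl : functor homod_category (nbhd_category R k P) :=
  @full_inclusion (nbhd_category R k P) holink_model.

Definition homod_forget : functor homod_category (strat_category R k P) :=
  functor_comp (forget_nbhd R k P) homod_incl.

End HoMod.
Arguments holink_functor R k {d} P.
Arguments DT_functor R k {d} P.
Arguments homod_category R k {d} P.
Arguments homod_incl R k {d} P.
Arguments homod_forget R k {d} P.

Definition pointwise_weak_equivalence (R : realType) (k : space_kind)
    (d : Order.disp_t) (P : porderType d) (C : category)
    (F G : functor C (diagram_category R k P)) (t : nat_trans F G) : Prop :=
  forall (X : C) (I : sd_category P),
    weak_equivalence R (component (component t X) I).

Definition weakly_equivalent (R : realType) (k : space_kind)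
    (d : Order.disp_t) (P : porderType d) (C : category)
    (F G : functor C (diagram_category R k P)) : Prop :=
  @zigzag (functor_category C (diagram_category R k P))
    (@pointwise_weak_equivalence R k d P C) F G.

(* Main.v *)
Require Import Defs.
From mathcomp Require Import all_boot all_order all_algebra.
From mathcomp Require Import all_classical reals topology normedtype.
From mathcomp Require Import ring lra.

(** Let [U(I)] be the intersection of the neighbourhoods [U(p)] for [p] in the
    flag [I]. Both diagrams are compared through links inside [U(I)]: the link of
    [I] in [U(I)], here [flag_link], restricts along faces because [U(I)] is
    contained in [U(I')] for [I'] contained in [I].

    Forgetting the neighbourhoods, [flag_link X I -> holink I X], is a weak
    equivalence. A compact family of stratum-preserving maps from the simplex of
    [I] is moved into [U(I)] by precomposition with a deformation of the simplex
    over [P] that pushes it, for each vertex of [I], close to the open stratum of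
    that vertex, relative to the distance from this stratum to the complement of
    the preimage of the neighbourhood ([shrink_into_vertices]). These preimages
    are neighbourhoods uniformly in the parameters, since a cube times a simplex is
    a retract over [P] of a larger simplex ([Delta_neighborhood_prism]) and the
    cube is compact ([tube_stratum]).

    Evaluation at the last vertex maps [flag_link X I] to the part [D(I)] of [U(I)]
    over the elements above the last one of [I], and it is a weak equivalence by
    the definition of a homotopy link model; but it is not natural, as the last
    vertex of a face may be another one. It is made natural by thickening [D(I)] to
    the space [dual_link X I] of those maps from the simplex of [I] to [X] that send
    the dual cell of each face [I'], in the barycentric subdivision, to [D(I')].
    These maps restrict along faces; constant maps embed [D(I)] as a deformation
    retract, by contraction to the barycenter ([dual_const_equivalence]); and
    [flag_link X I] is contained in [dual_link X I] by an inclusion that is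
    homotopic to evaluation at the last vertex followed by the constant maps
    ([flag_link_dual_equivalence]). The zigzag is
    [holink <- flag_link -> dual_link <- D].

    Weak equivalences are handled on representatives of homotopy classes
    ([weak_equivalenceP]). The first and the last homotopy move the base point,
    which is compensated in a collar of the cube ([equivalence_criterion_homotopic],
    [equivalence_criterion_compression]). *)

Set Implicit Arguments.
Unset Strict Implicit.
Unset Printing Implicit Defensive.

Import Order.TTheory GRing.Theory Num.Theory.
Import numFieldNormedType.Exports.

Local Open Scope classical_set_scope.
Local Open Scope ring_scope.

(** * Continuity of maps built from pieces *)

Section PointSet.

Lemma comp_cont (X Y Z : topologicalType) (f : X -> Y) (g : Y -> Z) :
  continuous f -> continuous g -> continuous (fun x => g (f x)).
Proof. by move=> cf cg x; apply: continuous_comp; [exact: cf|exact: cg]. Qed.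

Lemma eq_cont (X Y : topologicalType) (f g : X -> Y) :
  f =1 g -> continuous g -> continuous f.
Proof. by move=> /funext ->. Qed.

Lemma pair_cont (X Y Z : topologicalType) (f : Z -> X) (g : Z -> Y) :
  continuous f -> continuous g -> continuous (fun z => (f z, g z)).
Proof. by move=> cf cg z; apply: cvg_pair; [exact: cf|exact: cg]. Qed.

Lemma cst_cont (X Y : topologicalType) (y : Y) : continuous (fun _ : X => y).
Proof. by move=> x; exact: cvg_cst. Qed.

Lemma id_cont (X : topologicalType) : continuous (fun x : X => x).
Proof. by move=> x; exact: cvg_id. Qed.

Lemma fst_cont (X Y : topologicalType) : continuous (@fst X Y).
Proof. by move=> x; exact: cvg_fst. Qed.

Lemma snd_cont (X Y : topologicalType) : continuous (@snd X Y).
Proof. by move=> x; exact: cvg_snd. Qed.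

Lemma subtype_cont (T Z : topologicalType) (A : set T) (f : Z -> A) :
  continuous (fun z => set_val (f z) : T) -> continuous f.
Proof. exact: continuous_comp_initial. Qed.

Lemma val_cont (T : topologicalType) (A : set T) :
  continuous (fun a : A => set_val a : T).
Proof. exact: initial_continuous. Qed.

End PointSet.

Section RealFunctions.
Context (R : realType) (Z : topologicalType).
Implicit Types f g h : Z -> R.

Lemma contD f g :
  continuous f -> continuous g -> continuous (fun z => f z + g z).
Proof. by move=> cf cg z; apply: cvgD; [exact: cf|exact: cg]. Qed.

Lemma contB f g :
  continuous f -> continuous g -> continuous (fun z => f z - g z).
Proof. by move=> cf cg z; apply: cvgB; [exact: cf|exact: cg]. Qed.

Lemma contM f g :
  continuous f -> continuous g -> continuous (fun z => f z * g z).
Proof. by move=> cf cg z; apply: cvgM; [exact: cf|exact: cg]. Qed.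

Lemma contV f : (forall z, f z != 0) -> continuous f ->
  continuous (fun z => (f z)^-1).
Proof. by move=> f0 cf z; apply: cvgV; [exact: f0|exact: cf]. Qed.

Lemma cont_max f g :
  continuous f -> continuous g -> continuous (fun z => Num.max (f z) (g z)).
Proof. by move=> cf cg z; exact: (continuous_max (cf z) (cg z)). Qed.

Lemma cont_min f g :
  continuous f -> continuous g -> continuous (fun z => Num.min (f z) (g z)).
Proof. by move=> cf cg z; exact: (continuous_min (cf z) (cg z)). Qed.

Lemma cont_sum (J : Type) (s : seq J) (Q : pred J) (F : J -> Z -> R) :
  (forall j, continuous (F j)) ->
  continuous (fun z => \sum_(j <- s | Q j) F j z).
Proof.
by move=> cF z; apply: (cvg_sum_fun (nbhs_filter z)) => j _; exact: cF.
Qed.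

Lemma paste_cont (Y : topologicalType) h (f g : Z -> Y) :
  continuous h -> continuous f -> continuous g ->
  (forall z, h z = 0 -> f z = g z) ->
  continuous (fun z => if h z <= 0 then f z else g z).
Proof.
move=> ch cf cg fg; apply/continuous_closedP => C cC.
have -> : (fun z => if h z <= 0 then f z else g z) @^-1` C =
    (h @^-1` [set r | r <= 0] `&` f @^-1` C) `|`
    (h @^-1` [set r | 0 <= r] `&` g @^-1` C).
  apply/seteqP; split=> z /=.
    by case: (leP (h z) 0) => hz Cz; [left|right; split => //; exact: ltW].
  case=> -[hz Cz]; first by rewrite hz.
  case: (leP (h z) 0) => // hz0; rewrite fg //.
  by apply/eqP; rewrite eq_le hz hz0.
have pc (U : topologicalType) (k : Z -> U) (D : set U) :
    continuous k -> closed D -> closed (k @^-1` D).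
  by move=> ck; apply: preimage_closed => z _; exact: ck.
by apply: closedU; apply: closedI; apply: pc => //;
  (exact: closed_le || exact: closed_ge).
Qed.

Lemma row_cont n (f : Z -> 'rV[R]_n) :
  (forall j, continuous (fun z => f z ord0 j)) -> continuous f.
Proof.
move=> cf z U [V Vz VU].
have : \forall y \near z, forall j, V ord0 j (f y ord0 j).
  apply: (@filter_forall _ _ _ (nbhs z) (nbhs_filter z)) => j.
  by apply: cf; exact: Vz.
apply: filterS => y Vy; apply: VU => i j; rewrite ord1; exact: Vy.
Qed.

Lemma coord_cont n (A : set 'rV[R]_n) (f : Z -> A) j :
  continuous f -> continuous (fun z => (\val (f z) : 'rV[R]_n) ord0 j).
Proof.
move=> cf; apply: (@comp_cont _ _ _ _ (fun M : 'rV[R]_n => M ord0 j)).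
  exact: (comp_cont cf (@val_cont _ A)).
exact: coord_continuous.
Qed.

Lemma subrow_cont n (A : set 'rV[R]_n) (f : Z -> A) :
  (forall j, continuous (fun z => (\val (f z) : 'rV[R]_n) ord0 j)) ->
  continuous f.
Proof. by move=> cf; apply/subtype_cont/row_cont. Qed.

End RealFunctions.

Section UnitInterval.
Context (R : realType).
Local Notation I := (@unit_itv R).

Lemma itv_clampP (t : R) : @unit_itv R (Num.max 0 (Num.min 1 t)).
Proof. by rewrite /unit_itv /= le_max lexx /= ge_max ler01 ge_min lexx. Qed.

Definition itv_clamp (t : R) : I :=
  exist (fun t => t \in @unit_itv R) _ (mem_set (itv_clampP t)).

Arguments itv_clamp : simpl never.

Lemma itv_clampE (t : R) : 0 <= t <= 1 -> \val (itv_clamp t) = t.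
Proof. by case/andP => t0 t1; rewrite /itv_clamp /= min_r // max_r. Qed.

Lemma itv_clamp0 (t : R) : t <= 0 -> \val (itv_clamp t) = 0.
Proof. by move=> t0; rewrite /itv_clamp /= max_l // ge_min t0 orbT. Qed.

Lemma itv_clamp1 (t : R) : 1 <= t -> \val (itv_clamp t) = 1.
Proof. by move=> t1; rewrite /itv_clamp /= min_l // max_r. Qed.

Lemma itvP (t : I) : 0 <= \val t <= 1.
Proof. exact: (set_valP t). Qed.

Lemma itv_clampK (t : I) : itv_clamp (\val t) = t.
Proof. by apply: val_inj; rewrite itv_clampE // itvP. Qed.

Lemma itv_eq0 (t : I) : \val t = 0 -> t = itv_clamp 0.
Proof. by move=> t0; rewrite -[t]itv_clampK t0. Qed.

Lemma itv_eq1 (t : I) : \val t = 1 -> t = itv_clamp 1.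
Proof. by move=> t1; rewrite -[t]itv_clampK t1. Qed.

Lemma val01 : (\val (itv_clamp 0) = 0) * (\val (itv_clamp 1) = 1).
Proof. by split; [exact: itv_clamp0|exact: itv_clamp1]. Qed.

Lemma itv_val_cont : continuous (fun t : I => \val t : R).
Proof. exact: val_cont. Qed.

Lemma itv_clamp_cont (Z : topologicalType) (f : Z -> R) :
  continuous f -> continuous (fun z => itv_clamp (f z)).
Proof.
move=> cf; apply: subtype_cont; rewrite /itv_clamp /=.
apply: cont_max; first exact: cst_cont.
by apply: cont_min => //; exact: cst_cont.
Qed.

End UnitInterval.

(** * Weak equivalences without homotopy classes *)

Section Cubes.
Context (R : realType) (n : nat).
Local Notation C := (@cube R n).
Implicit Types c : C.

Definition cube_coord c i : R := (\val c : 'rV[R]_n) ord0 i.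

Lemma cube_coordP c i : 0 <= cube_coord c i <= 1.
Proof. exact: (set_valP c). Qed.

Lemma cube_coord_inj c c' : cube_coord c =1 cube_coord c' -> c = c'.
Proof. by move=> cc; apply: val_inj; apply/rowP => i; exact: cc. Qed.

Lemma cube_clampP (v : 'I_n -> R) :
  @cube R n (\row_i \val (itv_clamp (v i))).
Proof. by move=> i; rewrite mxE; exact: itvP. Qed.

Definition cube_clamp (v : 'I_n -> R) : C :=
  exist (fun w => w \in @cube R n) _ (mem_set (cube_clampP v)).

Lemma cube_clampE v i : cube_coord (cube_clamp v) i = \val (itv_clamp (v i)).
Proof. by rewrite /cube_coord /= mxE. Qed.

Lemma cube_clampK c : cube_clamp (cube_coord c) = c.
Proof.
apply: cube_coord_inj => i; rewrite cube_clampE itv_clampE //.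
exact: cube_coordP.
Qed.

Lemma cube_coord_cont (Z : topologicalType) (f : Z -> C) i :
  continuous f -> continuous (fun z => cube_coord (f z) i).
Proof. exact: coord_cont. Qed.

Lemma cube_clamp_cont (Z : topologicalType) (v : Z -> 'I_n -> R) :
  (forall i, continuous (v^~ i)) -> continuous (fun z => cube_clamp (v z)).
Proof.
move=> cv; apply: subrow_cont => j; rewrite [fun _ => _](_ : _ =
  fun z => \val (itv_clamp (v z j))); last by apply/funext => z; rewrite /= mxE.
exact: (comp_cont (itv_clamp_cont (cv j)) (@itv_val_cont R)).
Qed.

(** For [s = 0], the expansion of the inner cube [[1/4, 3/4]^n] onto the whole
    cube, which flattens the collar onto the boundary; for [s = 1], the identity. *)
Definition expand (s : R) c : C :=
  cube_clamp (fun i => (1 - s) * \val (itv_clamp (2 * cube_coord c i - 2^-1)) +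
                       s * cube_coord c i).

Lemma expand1 c : expand 1 c = c.
Proof.
rewrite /expand -[RHS]cube_clampK; congr cube_clamp; apply/funext => i.
by rewrite subrr mul0r add0r mul1r.
Qed.

Lemma expand_cont (Z : topologicalType) (s : Z -> R) (f : Z -> C) :
  continuous s -> continuous f -> continuous (fun z => expand (s z) (f z)).
Proof.
move=> cs cf; apply: cube_clamp_cont => i.
have cfi := @cube_coord_cont _ _ i cf.
apply: contD; apply: contM => //.
  by apply: contB => //; exact: cst_cont.
apply: (comp_cont (itv_clamp_cont _) (@itv_val_cont R)).
by apply: contB; [apply: contM => //|]; exact: cst_cont.
Qed.

Lemma expand_boundary s c : cube_boundary c -> cube_boundary (expand s c).
Proof.
move=> [i ci]; exists i; rewrite -/(cube_coord (expand s c) i) cube_clampE.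
move: ci; rewrite -/(cube_coord c i) => -[] ->; [left|right].
  by rewrite [\val (itv_clamp (_ - _))]itv_clamp0 ?mulr0 ?addr0 ?val01 //; lra.
rewrite [\val (itv_clamp (_ - _))]itv_clamp1; last by lra.
by rewrite !mulr1 subrK val01.
Qed.

(** The distance to the boundary for the maximum norm; it is 1 in dimension zero,
    where there is no boundary. *)
Definition cube_depth c : R :=
  \big[Num.min/1]_(i < n) Num.min (cube_coord c i) (1 - cube_coord c i).

Lemma cube_depth_cont (Z : topologicalType) (f : Z -> C) :
  continuous f -> continuous (fun z => cube_depth (f z)).
Proof.
move=> cf; rewrite /cube_depth; elim: (index_enum _) => [|i s IH].
  by under eq_fun do rewrite big_nil; exact: cst_cont.
under eq_fun do rewrite big_cons.
have cfi := @cube_coord_cont _ _ i cf.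
by apply: cont_min => //; apply: cont_min => //; apply: contB => //;
  exact: cst_cont.
Qed.

Lemma cube_depthP c (r : R) : r < 1 -> cube_depth c <= r ->
  exists i, cube_coord c i <= r \/ 1 - cube_coord c i <= r.
Proof.
rewrite /cube_depth => r1; elim: (index_enum _) => [|i s IH].
  by rewrite big_nil leNgt r1.
rewrite big_cons ge_min => /orP[|/IH //].
by rewrite ge_min => /orP ?; exists i.
Qed.

Lemma cube_depth_boundary c : cube_boundary c -> cube_depth c <= 0.
Proof.
move=> [i ci]; rewrite /cube_depth (bigD1 i) //= ge_min ge_min.
move: ci; rewrite -/(cube_coord c i) => -[] ->; first by rewrite lexx.
by rewrite subrr lexx orbT.
Qed.

Lemma expand_collar c : cube_depth c <= 4^-1 -> cube_boundary (expand 0 c).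
Proof.
move=> /cube_depthP[|i ci]; first by lra.
exists i; rewrite -/(cube_coord (expand 0 c) i) cube_clampE subr0 mul1r mul0r.
rewrite addr0 itv_clampK; case: ci => ci; [left|right].
  by rewrite itv_clamp0 //; lra.
by rewrite itv_clamp1 //; lra.
Qed.

(** Zero on the boundary, one on the inner cube. *)
Definition ramp c : @unit_itv R := itv_clamp (4 * cube_depth c).

Lemma ramp_cont (Z : topologicalType) (f : Z -> C) :
  continuous f -> continuous (fun z => ramp (f z)).
Proof.
move=> cf; apply: itv_clamp_cont; apply: contM; first exact: cst_cont.
exact: cube_depth_cont.
Qed.

Lemma ramp_boundary c : cube_boundary c -> ramp c = itv_clamp 0.
Proof.
by move=> /cube_depth_boundary dc; apply: itv_eq0; rewrite itv_clamp0 //; lra.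
Qed.

Lemma ramp_inner c : 4^-1 <= cube_depth c -> ramp c = itv_clamp 1.
Proof. by move=> dc; apply: itv_eq1; rewrite itv_clamp1 //; lra. Qed.

End Cubes.

Section HomotopyRelations.
Context (R : realType).
Local Notation I := (@unit_itv R).

Definition itv_rev (t : I) : I := itv_clamp (1 - \val t).

Lemma itv_rev_cont (Z : topologicalType) (f : Z -> I) :
  continuous f -> continuous (fun z => itv_rev (f z)).
Proof.
move=> cf; apply: itv_clamp_cont; apply: contB; first exact: cst_cont.
exact: (comp_cont cf (@itv_val_cont R)).
Qed.

Lemma itv_rev0 : itv_rev (itv_clamp 0) = itv_clamp 1.
Proof. by rewrite /itv_rev val01 subr0. Qed.

Lemma itv_rev1 : itv_rev (itv_clamp 1) = itv_clamp 0.
Proof. by rewrite /itv_rev val01 subrr. Qed.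

(** The paths of [joined] are concatenated as homotopies that are constant in the
    second variable. *)
Lemma concat_cont (X Z : topologicalType) (G H : I * Z -> X) :
  continuous G -> continuous H ->
  (forall z, G (itv_clamp 1, z) = H (itv_clamp 0, z)) ->
  exists K : I * Z -> X, [/\ continuous K,
    forall z, K (itv_clamp 0, z) = G (itv_clamp 0, z),
    forall z, K (itv_clamp 1, z) = H (itv_clamp 1, z) &
    forall tz, exists s, K tz = G (s, tz.2) \/ K tz = H (s, tz.2)].
Proof.
move=> cG cH GH.
pose g (tz : I * Z) := (itv_clamp (2 * \val tz.1), tz.2).
pose h (tz : I * Z) := (itv_clamp (2 * \val tz.1 - 1), tz.2).
have cv : continuous (fun tz : I * Z => \val tz.1 : R).
  exact: (comp_cont (@fst_cont _ _) (@itv_val_cont R)).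
have c2 : continuous (fun tz : I * Z => 2 * \val tz.1 : R).
  by apply: contM => //; exact: cst_cont.
have cg : continuous g.
  by apply: pair_cont; [exact: itv_clamp_cont|exact: snd_cont].
have ch : continuous h.
  apply: pair_cont; last exact: snd_cont.
  by apply: itv_clamp_cont; apply: contB => //; exact: cst_cont.
exists (fun tz => if \val tz.1 - 2^-1 <= 0 then G (g tz) else H (h tz)).
split.
- apply: paste_cont.
  + by apply: contB => //; exact: cst_cont.
  + exact: comp_cont cg cG.
  + exact: comp_cont ch cH.
  + move=> [t z] /eqP; rewrite subr_eq0 => /eqP tE; rewrite /g /h tE.
    by rewrite divff ?pnatr_eq0 // subrr GH.
- move=> z; rewrite /g [fst _]/= val01 ifT; last by lra.
  by rewrite mulr0.
- move=> z; rewrite /h [fst _]/= val01 ifF; last by apply/negbTE; rewrite -ltNge; lra.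
  by congr (H (itv_clamp _, z)); lra.
- by move=> tz; case: ifP => _; [exists (g tz).1; left|exists (h tz).1; right].
Qed.

Section Joined.
Context (X : topologicalType).
Implicit Types x y z : X.

Lemma joinedP x y : joined R x y <-> exists g : I -> X,
  [/\ continuous g, g (itv_clamp 0) = x & g (itv_clamp 1) = y].
Proof.
split=> -[g [cg g0 g1]]; exists g; split => //.
- by apply: g0; rewrite val01.
- by apply: g1; rewrite val01.
- by move=> t /itv_eq0 ->.
- by move=> t /itv_eq1 ->.
Qed.

Lemma joined_refl x : joined R x x.
Proof. by exists (fun=> x); split => //; exact: cst_cont. Qed.

Lemma joined_sym x y : joined R x y -> joined R y x.
Proof.
move=> /joinedP[g [cg g0 g1]]; apply/joinedP; exists (fun t => g (itv_rev t)).
split; rewrite ?itv_rev0 ?itv_rev1 //.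
by apply: comp_cont cg; apply: itv_rev_cont; exact: id_cont.
Qed.

Lemma joined_trans x y z : joined R x y -> joined R y z -> joined R x z.
Proof.
move=> /joinedP[g [cg g0 g1]] /joinedP[h [ch h0 h1]]; apply/joinedP.
have [||s|K [cK K0 K1 _]] := @concat_cont X I (fun tz => g tz.1) (fun tz => h tz.1).
- exact: comp_cont (@fst_cont _ _) cg.
- exact: comp_cont (@fst_cont _ _) ch.
- by rewrite /= g1 h0.
exists (fun t => K (t, itv_clamp 0)); rewrite K0 K1; split => //.
by apply: comp_cont cK; apply: pair_cont; [exact: id_cont|exact: cst_cont].
Qed.

Lemma joined_eq x y : joined R x y <-> joined R x = joined R y.
Proof.
split=> [xy|->]; last exact: joined_refl.
apply/seteqP; split=> z; apply: joined_trans => //; exact: joined_sym.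
Qed.

End Joined.

Section Homotopic.
Context (n : nat) (X : topologicalType) (x0 : X).
Implicit Types a b : @cube R n -> X.

Lemma homotopicP a b : homotopic_rel x0 a b <->
  exists H : I * @cube R n -> X, [/\ continuous H,
    forall c, H (itv_clamp 0, c) = a c, forall c, H (itv_clamp 1, c) = b c &
    forall t c, cube_boundary c -> H (t, c) = x0].
Proof.
split=> -[H [cH H0 H1 Hb]]; exists H; split => //.
- by move=> c; apply: H0; rewrite val01.
- by move=> c; apply: H1; rewrite val01.
- by move=> t c /itv_eq0 ->.
- by move=> t c /itv_eq1 ->.
Qed.

Lemma homotopic_refl a : spheroid x0 a -> homotopic_rel x0 a a.
Proof.
move=> [ca ba]; exists (fun tc => a tc.2); split => //.
exact: comp_cont (@snd_cont _ _) ca.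
Qed.

Lemma homotopic_sym a b : homotopic_rel x0 a b -> homotopic_rel x0 b a.
Proof.
move=> /homotopicP[H [cH H0 H1 Hb]]; apply/homotopicP.
exists (fun tc => H (itv_rev tc.1, tc.2)).
split=> [|c|c|t c bc] /=; rewrite ?itv_rev0 ?itv_rev1 ?H0 ?H1 ?Hb //.
apply: comp_cont cH; apply: pair_cont; last exact: snd_cont.
by apply: itv_rev_cont; exact: fst_cont.
Qed.

Lemma homotopic_trans a b (c : @cube R n -> X) :
  homotopic_rel x0 a b -> homotopic_rel x0 b c -> homotopic_rel x0 a c.
Proof.
move=> /homotopicP[G [cG G0 G1 Gb]] /homotopicP[H [cH H0 H1 Hb]].
have [z|K [cK K0 K1 KGH]] := concat_cont cG cH; first by rewrite G1 H0.
apply/homotopicP; exists K; split => // [z|z|t z bz]; rewrite ?K0 ?K1 //.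
by have [s [|] ->] := KGH (t, z); [exact: Gb|exact: Hb].
Qed.

Lemma homotopic_spheroid a b : homotopic_rel x0 a b -> spheroid x0 b.
Proof.
move=> /homotopicP[H [cH H0 H1 Hb]]; split=> [|c bc]; last by rewrite -H1 Hb.
rewrite (_ : b = fun c => H (itv_clamp 1, c)).
  by apply: comp_cont cH; apply: pair_cont; [exact: cst_cont|exact: id_cont].
by apply/funext => c; rewrite H1.
Qed.

Lemma homotopic_eq a b : spheroid x0 b ->
  homotopic_rel x0 a b <-> homotopic_rel x0 a = homotopic_rel x0 b.
Proof.
move=> sb; split=> [ab|->]; last exact: homotopic_refl.
apply/seteqP; split=> c; apply: homotopic_trans => //; exact: homotopic_sym.
Qed.

Lemma homotopic_expand a : spheroid x0 a ->
  homotopic_rel x0 (fun c => a (expand 0 c)) a.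
Proof.
move=> [ca ba]; apply/homotopicP.
exists (fun tc => a (expand (\val tc.1) tc.2)); split => /=.
- apply: comp_cont ca; apply: expand_cont; last exact: snd_cont.
  exact: comp_cont (@fst_cont _ _) (@itv_val_cont R).
- by move=> c; congr (a (expand _ c)); exact: itv_clamp0.
- move=> c; rewrite -[in RHS](expand1 c); congr (a (expand _ c)).
  exact: itv_clamp1.
- by move=> t c bc; apply/ba/expand_boundary.
Qed.

End Homotopic.

Section Induced.
Context (X Y : topologicalType) (f : X -> Y).

Lemma joined_map x y : continuous f -> joined R x y -> joined R (f x) (f y).
Proof.
move=> cf /joinedP[g [cg <- <-]]; apply/joinedP; exists (fun t => f (g t)).
by split => //; exact: comp_cont cg cf.
Qed.

Lemma homotopic_map n x0 (a b : @cube R n -> X) : continuous f ->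
  homotopic_rel x0 a b -> homotopic_rel (f x0) (f \o a) (f \o b).
Proof.
move=> cf [H [cH H0 H1 Hb]]; exists (fun tc => f (H tc)); split.
- exact: comp_cont cH cf.
- by move=> t c t0; rewrite /= H0.
- by move=> t c t0; rewrite /= H1.
- by move=> t c bc; rewrite Hb.
Qed.

Lemma spheroid_map n x0 (a : @cube R n -> X) : continuous f ->
  spheroid x0 a -> spheroid (f x0) (f \o a).
Proof.
by move=> cf [ca ba]; split=> [|c bc]; [exact: comp_cont ca cf|rewrite /= ba].
Qed.

Lemma path_components_map_joined x : continuous f ->
  path_components_map R f (joined R x) = joined R (f x).
Proof.
move=> cf; apply/seteqP; split=> y /=; last by exists x => //; exact: joined_refl.
by move=> [z /(joined_map cf) xz]; exact: joined_trans.
Qed.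

Lemma homotopy_group_map_rel n x0 (a : @cube R n -> X) : continuous f ->
  spheroid x0 a ->
  homotopy_group_map f x0 (homotopic_rel x0 a) = homotopic_rel (f x0) (f \o a).
Proof.
move=> cf sa; apply/seteqP; split=> b /=.
  by move=> [c /(homotopic_map cf) ac]; exact: homotopic_trans.
by exists a => //; exact: homotopic_refl.
Qed.

End Induced.

(** The injectivity and surjectivity on path components and on homotopy groups,
    with representatives in place of classes. *)
Variant equivalence_criterion (X Y : topologicalType) (f : X -> Y) : Prop :=
  EquivalenceCriterion of
    (forall y, exists x, joined R (f x) y) &
    (forall x x', joined R (f x) (f x') -> joined R x x') &
    (forall n x0 (b : @cube R n.+1 -> Y), spheroid (f x0) b ->
       exists2 a, spheroid x0 a & homotopic_rel (f x0) (f \o a) b) &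
    (forall n x0 (a a' : @cube R n.+1 -> X), spheroid x0 a -> spheroid x0 a' ->
       homotopic_rel (f x0) (f \o a) (f \o a') -> homotopic_rel x0 a a').

Lemma weak_equivalenceP (X Y : topologicalType) (f : continuousType X Y) :
  weak_equivalence R f <-> equivalence_criterion f.
Proof.
have cf : continuous f := @cts_fun _ _ f; split.
  move=> [[_ inj0 sur0] bij]; split.
  - move=> y; have [_ [x _ <-]] := sur0 _ (ex_intro2 _ _ y Logic.I erefl).
    by rewrite path_components_map_joined // => fxy; exists x; apply/joined_eq.
  - move=> x x' /joined_eq fxx'; apply/joined_eq; apply: inj0.
    + by apply: mem_set; exists x.
    + by apply: mem_set; exists x'.
    + by rewrite !path_components_map_joined.
  - move=> n x0 b sb; have [_ _ sur] := bij n x0.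
    have [_ [a sa <-]] := sur _ (ex_intro2 _ _ b sb erefl).
    by rewrite homotopy_group_map_rel // => /homotopic_eq ab; exists a => //; exact: ab.
  - move=> n x0 a a' sa sa' /homotopic_eq aa'; have [_ inj _] := bij n x0.
    apply/homotopic_eq => //; apply: inj.
    + by apply: mem_set; exists a.
    + by apply: mem_set; exists a'.
    + by rewrite !homotopy_group_map_rel // aa' //; exact: spheroid_map.
move=> [sur0 inj0 sur inj]; split.
  split.
  - by move=> _ [x _ <-]; rewrite path_components_map_joined //; exists (f x).
  - move=> C C' /set_mem[x _ <-] /set_mem[x' _ <-].
    by rewrite !path_components_map_joined // => /joined_eq/inj0/joined_eq.
  - move=> _ [y _ <-]; have [x /joined_eq fxy] := sur0 y.
    by exists (joined R x); [exists x|rewrite path_components_map_joined].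
move=> n x0; split.
- move=> _ [a sa <-]; rewrite homotopy_group_map_rel //.
  by exists (f \o a) => //; exact: spheroid_map.
- move=> C C' /set_mem[a sa <-] /set_mem[a' sa' <-].
  rewrite !homotopy_group_map_rel // => aa'.
  apply/homotopic_eq => //; apply: inj => //.
  by rewrite aa'; apply: homotopic_refl; exact: spheroid_map.
- move=> _ [b sb <-]; have [a sa ab] := sur n x0 b sb.
  exists (homotopic_rel x0 a); first by exists a.
  by rewrite homotopy_group_map_rel //; apply/homotopic_eq.
Qed.

Lemma equivalence_criterion_comp (X Y Z : topologicalType)
    (f : X -> Y) (g : Y -> Z) : continuous f -> continuous g ->
  equivalence_criterion f -> equivalence_criterion g ->
  equivalence_criterion (g \o f).
Proof.
move=> cf cg [fsur0 finj0 fsur finj] [gsur0 ginj0 gsur ginj]; split.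
- move=> z; have [y yz] := gsur0 z; have [x xy] := fsur0 y.
  by exists x; apply: joined_trans yz; exact: (joined_map cg xy).
- by move=> x x' /ginj0/finj0.
- move=> n x0 b /gsur[a /[dup] sa /fsur[a' sa' aa'] ab]; exists a' => //.
  by apply: homotopic_trans ab; exact: (homotopic_map cg aa').
- move=> n x0 a a' sa sa' /ginj aa'; apply: finj => //; apply: aa';
  exact: spheroid_map.
Qed.

End HomotopyRelations.

(** * Homotopies that test spaces see *)

Section TestSpaces.
Context (R : realType).
Local Notation I := (@unit_itv R).

(** The domains of the maps that enter the comparison of homotopy groups: cubes,
    the interval, and the product of both. *)
Definition cube_retract (Q : topologicalType) : Prop :=
  exists m (i : Q -> @cube R m) (r : @cube R m -> Q),
    [/\ continuous i, continuous r & cancel i r].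

Lemma cube_retract_cube n : cube_retract (@cube R n).
Proof. by exists n, id, id; split => //; exact: id_cont. Qed.

Lemma cube_retract_prism n : cube_retract (I * @cube R n : topologicalType)%type.
Proof.
pose i (tc : I * @cube R n) : @cube R n.+1 := cube_clamp (fun j =>
  if unlift ord0 j is Some l then cube_coord tc.2 l else \val tc.1).
pose r (w : @cube R n.+1) : I * @cube R n :=
  (itv_clamp (cube_coord w ord0), cube_clamp (fun l => cube_coord w (lift ord0 l))).
exists n.+1, i, r; split.
- apply: cube_clamp_cont => j; case: (unlift ord0 j) => [l|].
    by apply: cube_coord_cont; exact: snd_cont.
  exact: (comp_cont (@fst_cont _ _) (@itv_val_cont R)).
- apply: pair_cont.
    by apply: itv_clamp_cont; apply: cube_coord_cont; exact: id_cont.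
  by apply: cube_clamp_cont => l; apply: cube_coord_cont; exact: id_cont.
- move=> [t c]; congr pair.
    by rewrite cube_clampE unlift_none !itv_clampK.
  apply: cube_coord_inj => l; rewrite 2!cube_clampE liftK itv_clampK.
  by rewrite -cube_clampE cube_clampK.
Qed.

Lemma cube_retract_itv : cube_retract I.
Proof.
exists 1, (fun t => cube_clamp (fun=> \val t)), (fun w => itv_clamp (cube_coord w ord0)).
split.
- by apply: cube_clamp_cont => j; exact: itv_val_cont.
- by apply: itv_clamp_cont; apply: cube_coord_cont; exact: id_cont.
- by move=> t; rewrite cube_clampE !itv_clampK.
Qed.

(** The homotopies of mapping spaces that occur below come from deformations of a
    simplex; their continuity is tested against maps out of cubes, where it becomes
    the continuity of a map on a product with the simplex. *)
Definition cube_homotopy (X Y : topologicalType) (H : I -> X -> Y) : Prop :=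
  forall Q, cube_retract Q -> forall a : Q -> X, continuous a ->
  continuous (fun tq : I * Q => H tq.1 (a tq.2)).

End TestSpaces.

(** * Change of base point *)

Section BasePoint.
Context (R : realType).
Local Notation I := (@unit_itv R).

Lemma itv_revK (t : I) : itv_rev (itv_rev t) = t.
Proof.
rewrite /itv_rev itv_clampE; first by rewrite opprB addrC subrK itv_clampK.
by have := itvP t; lra.
Qed.

Section Path.
Context (n : nat) (Y : topologicalType).
Implicit Types (g : I -> Y) (a b : @cube R n -> Y).

Definition free_homotopy g a b : Prop :=
  exists H : I * @cube R n -> Y, [/\ continuous H,
    forall c, H (itv_clamp 0, c) = a c, forall c, H (itv_clamp 1, c) = b c &
    forall t c, cube_boundary c -> H (t, c) = g t].

Lemma free_homotopy_sym g a b :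
  free_homotopy g a b -> free_homotopy (fun t => g (itv_rev t)) b a.
Proof.
move=> [H [cH H0 H1 Hb]]; exists (fun tc => H (itv_rev tc.1, tc.2)).
split=> [|c|c|t c bc] /=; rewrite ?itv_rev0 ?itv_rev1 ?H0 ?H1 ?Hb //.
apply: comp_cont cH; apply: pair_cont; last exact: snd_cont.
by apply: itv_rev_cont; exact: fst_cont.
Qed.

(** The spheroid [a] shrunk into the inner cube, with the collar running along
    the path from the old base point to the new one. *)
Definition transport g a (c : @cube R n) : Y :=
  if 4^-1 - cube_depth c <= 0 then a (expand 0 c) else g (itv_rev (ramp c)).

Lemma transport_boundary g a c : cube_boundary c ->
  transport g a c = g (itv_clamp 1).
Proof.
move=> bc; rewrite /transport ifF ?ramp_boundary ?itv_rev0 //.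
by apply/negbTE; rewrite -ltNge; have := cube_depth_boundary bc; lra.
Qed.

Section Transport.
Context (g : I -> Y) (y0 y1 : Y) (cg : continuous g)
  (g0 : g (itv_clamp 0) = y0) (g1 : g (itv_clamp 1) = y1).

Lemma transport_paste (w : I * @cube R n -> I) (G : I * @cube R n -> Y) :
  continuous w -> continuous G ->
  (forall t c, 4^-1 <= cube_depth c -> w (t, c) = itv_clamp 0) ->
  (forall t c, cube_boundary c -> G (t, c) = y0) ->
  continuous (fun tc => if 4^-1 - cube_depth tc.2 <= 0
    then G (tc.1, expand 0 tc.2) else g (w tc)).
Proof.
move=> cw cG w0 Gb; apply: paste_cont.
- apply: contB; first exact: cst_cont.
  by apply: cube_depth_cont; exact: snd_cont.
- apply: comp_cont cG; apply: pair_cont; first exact: fst_cont.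
  by apply: expand_cont; [exact: cst_cont|exact: snd_cont].
- exact: comp_cont cw cg.
- move=> [t c] /eqP; rewrite subr_eq0 => /eqP dc /=.
  by rewrite w0 ?dc // g0 Gb //; apply: expand_collar; rewrite -dc.
Qed.

Let rev_ramp_cont : continuous (fun tc : I * @cube R n => itv_rev (ramp tc.2)).
Proof. by apply: itv_rev_cont; apply: ramp_cont; exact: snd_cont. Qed.

Let rev_ramp_inner (c : @cube R n) :
  4^-1 <= cube_depth c -> itv_rev (ramp c) = itv_clamp 0.
Proof. by move=> dc; rewrite ramp_inner // itv_rev1. Qed.

Lemma transport_homotopic a b : homotopic_rel y0 a b ->
  homotopic_rel y1 (transport g a) (transport g b).
Proof.
move=> /homotopicP[H [cH H0 H1 Hb]]; apply/homotopicP.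
eexists; split.
- by apply: (transport_paste rev_ramp_cont cH) => // t c; exact: rev_ramp_inner.
- by move=> c; rewrite /= H0.
- by move=> c; rewrite /= H1.
- by move=> t c bc; rewrite -g1 -(transport_boundary g (fun e => H (t, e)) bc).
Qed.

(** The path enters the collar gradually. *)
Lemma free_homotopy_transport a : spheroid y0 a ->
  free_homotopy g (fun c => a (expand 0 c)) (transport g a).
Proof.
move=> [ca ba].
pose w (tc : I * @cube R n) := itv_clamp (\val tc.1 * \val (itv_rev (ramp tc.2))).
have cw : continuous w.
  apply: itv_clamp_cont; apply: contM.
    exact: (comp_cont (@fst_cont _ _) (@itv_val_cont R)).
  exact: (comp_cont rev_ramp_cont (@itv_val_cont R)).
have cG : continuous (fun tc : I * @cube R n => a tc.2).
  exact: comp_cont (@snd_cont _ _) ca.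
eexists; split.
- apply: (transport_paste cw cG) => [t c dc|t c /ba //].
  by rewrite /w rev_ramp_inner // [\val (itv_clamp 0)]itv_clamp0 // mulr0.
- move=> c; cbn [fst snd]; case: ifPn => //; rewrite -ltNge => dc.
  rewrite /w; cbn [fst snd]; rewrite [\val (itv_clamp 0)]itv_clamp0 // mul0r g0 ba //.
  by apply: expand_collar; lra.
- move=> c; rewrite /w /transport; cbn [fst snd].
  rewrite [\val (itv_clamp 1)]itv_clamp1 //.
  by rewrite mul1r itv_clampK.
- move=> t c bc; cbn [fst snd]; rewrite ifF.
    rewrite /w; cbn [fst snd]; rewrite ramp_boundary // itv_rev0.
    by rewrite [\val (itv_clamp 1)]itv_clamp1 // mulr1 itv_clampK.
  by apply/negbTE; rewrite -ltNge; have := cube_depth_boundary bc; lra.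
Qed.

(** On the collar the free homotopy itself supplies the path; letting its time run
    up to 1 everywhere turns the transported spheroid into [b]. *)
Lemma transport_free a b : free_homotopy g a b -> spheroid y1 b ->
  homotopic_rel y1 (transport g a) b.
Proof.
move=> [H [cH H0 H1 Hb]] sb; apply: homotopic_trans (homotopic_expand sb).
apply/homotopicP.
exists (fun sc => H (itv_clamp (Num.max (\val sc.1) (\val (itv_rev (ramp sc.2)))),
  expand 0 sc.2)); split.
- apply: comp_cont cH; apply: pair_cont; last first.
    by apply: expand_cont; [exact: cst_cont|exact: snd_cont].
  apply: itv_clamp_cont; apply: cont_max.
    exact: (comp_cont (@fst_cont _ _) (@itv_val_cont R)).
  exact: (comp_cont rev_ramp_cont (@itv_val_cont R)).
- move=> c; rewrite [fst _]/= itv_clamp0 // max_r; last first.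
    by have /andP[] := itvP (itv_rev (ramp c)).
  rewrite itv_clampK /transport; case: ifPn => dc /=.
    by rewrite rev_ramp_inner ?H0 //; lra.
  by rewrite Hb //; apply: expand_collar; move: dc; rewrite -ltNge; lra.
- move=> c; rewrite [fst _]/= itv_clamp1 // max_l ?H1 //.
  by have /andP[] := itvP (itv_rev (ramp c)).
- move=> t c bc; rewrite [snd _]/= ramp_boundary // itv_rev0 Hb; last first.
    exact: expand_boundary.
  rewrite itv_clamp1 // max_r //.
  by have /andP[] := itvP t.
Qed.

End Transport.
End Path.

(** A homotopy moves the base point along a path; transport along this path
    turns a bijection on homotopy groups for one end into one for the other. *)
Lemma equivalence_criterion_homotopic (X Y : topologicalType) (H : I -> X -> Y) :
  cube_homotopy H -> equivalence_criterion R (H (itv_clamp 0)) ->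
  equivalence_criterion R (H (itv_clamp 1)).
Proof.
move=> cH [sur0 inj0 sur inj].
have cH1 (x : X) : continuous (H ^~ x).
  apply: (@comp_cont _ _ _ (fun t => (t, t)) (fun ts => H ts.1 ((fun=> x) ts.2))).
    by apply: pair_cont; exact: id_cont.
  by apply: cH; [exact: cube_retract_itv|exact: cst_cont].
have Hx (x : X) : joined R (H (itv_clamp 0) x) (H (itv_clamp 1) x).
  by apply/joinedP; exists (H ^~ x).
have free n (x0 : X) (a : @cube R n -> X) : spheroid x0 a ->
    free_homotopy (H ^~ x0) (H (itv_clamp 0) \o a) (H (itv_clamp 1) \o a).
  move=> [ca ba]; exists (fun tc => H tc.1 (a tc.2)); split => //.
    by apply: cH ca; exact: cube_retract_cube.
  by move=> t c bc /=; rewrite ba.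
have sph n (x0 : X) (a : @cube R n -> X) t : spheroid x0 a ->
    spheroid (H t x0) (H t \o a).
  move=> [ca ba]; split=> [|c bc]; last by rewrite /= ba.
  apply: (@comp_cont _ _ _ (fun c => (t, c)) (fun tc => H tc.1 (a tc.2))).
    by apply: pair_cont; [exact: cst_cont|exact: id_cont].
  by apply: cH ca; exact: cube_retract_cube.
have crev (x0 : X) : continuous (fun t => H (itv_rev t) x0).
  by apply: comp_cont (cH1 x0); apply: itv_rev_cont; exact: id_cont.
split.
- by move=> y; have [x xy] := sur0 y; exists x; apply: joined_trans xy;
    exact: joined_sym.
- move=> x x' xx'; apply: inj0; apply: joined_trans (Hx x) _.
  by apply: joined_trans xx' _; exact: joined_sym.
- move=> n x0 b sb.
  (* [b] is transported back to the other end, lifted there, and what is obtained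
     is transported forth again. *)
  pose b' := transport (fun t => H (itv_rev t) x0) b.
  have rev0 : H (itv_rev (itv_clamp 0)) x0 = H (itv_clamp 1) x0 by rewrite itv_rev0.
  have rev1 : H (itv_rev (itv_clamp 1)) x0 = H (itv_clamp 0) x0 by rewrite itv_rev1.
  have sb' : spheroid (H (itv_clamp 0) x0) b'.
    exact: homotopic_spheroid (transport_homotopic (crev x0) rev0 rev1 (homotopic_refl sb)).
  have [a sa ab'] := sur n x0 b' sb'; exists a => //.
  have /homotopic_sym/homotopic_trans :=
    transport_free erefl (free _ x0 a sa) (sph _ x0 a _ sa).
  apply; apply: homotopic_trans (transport_homotopic (cH1 x0) erefl erefl ab') _.
  have /free_homotopy_sym := free_homotopy_transport (crev x0) rev0 sb.
  under eq_fun do rewrite itv_revK; move=> b'b.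
  have seb := homotopic_spheroid (homotopic_sym (homotopic_expand sb)).
  apply: homotopic_trans (homotopic_expand sb).
  exact: (transport_free erefl b'b seb).
- move=> n x0 a a' sa sa' aa'; apply: inj => //.
  have rev0 : H (itv_rev (itv_clamp 0)) x0 = H (itv_clamp 1) x0 by rewrite itv_rev0.
  have rev1 : H (itv_rev (itv_clamp 1)) x0 = H (itv_clamp 0) x0 by rewrite itv_rev1.
  (* Transport back along the path undoes the homotopy. *)
  have back (b : @cube R n.+1 -> X) : spheroid x0 b -> homotopic_rel (H (itv_clamp 0) x0)
      (transport (fun t => H (itv_rev t) x0) (H (itv_clamp 1) \o b))
      (H (itv_clamp 0) \o b).
    move=> sb; apply: (transport_free (g := fun t => H (itv_rev t) x0) rev1 _ (sph n.+1 x0 b _ sb)).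
    exact: free_homotopy_sym (free _ _ _ sb).
  apply: homotopic_trans (homotopic_sym (back a sa)) _.
  apply: homotopic_trans (back a' sa').
  exact: (transport_homotopic (crev x0) rev0 rev1 aa').
Qed.

End BasePoint.

(** * Two sources of weak equivalences *)

Section Sources.
Context (R : realType).
Local Notation I := (@unit_itv R).

(** The deformation fixes the retract, hence the base points. *)
Lemma equivalence_criterion_deformation (D E : topologicalType)
    (s : D -> E) (r : E -> D) (H : I -> E -> E) :
  continuous s -> continuous r -> cancel s r -> cube_homotopy H ->
  (forall e, H (itv_clamp 0) e = s (r e)) -> (forall e, H (itv_clamp 1) e = e) ->
  (forall t x, H t (s x) = s x) -> equivalence_criterion R s.
Proof.
move=> cs cr sK cH H0 H1 Hs; split.
- move=> e; exists (r e); apply/joinedP; exists (H ^~ e); split => //.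
  apply: (@comp_cont _ _ _ (fun t => (t, t)) (fun ts => H ts.1 ((fun=> e) ts.2))).
    by apply: pair_cont; exact: id_cont.
  by apply: cH; [exact: cube_retract_itv|exact: cst_cont].
- by move=> x x' /(joined_map cr); rewrite !sK.
- move=> n x0 b sb; exists (r \o b).
    by have := spheroid_map cr sb; rewrite sK.
  have [cb bb] := sb; apply/homotopicP.
  exists (fun tc => H tc.1 (b tc.2)); split => //.
  + by apply: cH cb; exact: cube_retract_cube.
  + by move=> t c bc; rewrite /= bb.
- move=> n x0 a a' sa sa' /(homotopic_map cr); rewrite sK.
  have rs (b : @cube R n.+1 -> D) : r \o (s \o b) = b.
    by apply/funext => c; rewrite /= sK.
  by rewrite !rs.
Qed.

(** A family is first expanded, so that it is constant on the collar of the cube,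
    and then deformed for a time given by the ramp. On the inner cube the
    deformation runs to its end, which is in [A]; on the collar it applies to the
    base point, whose deformation stays in [A] all the time; and on the boundary it
    does not start. *)
Lemma equivalence_criterion_compression (A Y : topologicalType) (j : A -> Y) :
  injective j ->
  (forall Q, cube_retract R Q -> forall a : Q -> A,
     continuous (fun q => j (a q)) -> continuous a) ->
  (forall Q, cube_retract R Q -> forall a : Q -> Y, continuous a ->
     exists H : I -> Y -> Y, [/\ forall y, H (itv_clamp 0) y = y,
       forall t x, range j (H t (j x)), forall q, range j (H (itv_clamp 1) (a q)) &
       continuous (fun tq : I * Q => H tq.1 (a tq.2))]) ->
  equivalence_criterion R j.
Proof.
move=> jI cj def.
have lift (Q : topologicalType) (b : Q -> Y) : cube_retract R Q ->
    continuous b -> (forall q, range j (b q)) ->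
    exists2 a : Q -> A, continuous a & forall q, j (a q) = b q.
  move=> cQ cb br.
  have /choice[a ab] : forall q, exists x, j x = b q.
    by move=> q; have [x _ xq] := br q; exists x.
  exists a => //; apply: cj => //.
  by rewrite (_ : (fun q => _) = b) //; exact/funext.
split.
- move=> y; have cy : continuous (fun _ : I => y) by exact: cst_cont.
  have [H [H0 _ H1 cH]] := def _ (cube_retract_itv R) _ cy.
  have [x _ xy] := H1 (itv_clamp 0).
  exists x; apply: joined_sym; apply/joinedP; exists (H ^~ y); split => //.
  apply: (@comp_cont _ _ _ (fun t => (t, t)) _) cH.
  by apply: pair_cont; exact: id_cont.
- move=> x x' /joinedP[g [cg g0 g1]].
  have [H [H0 Hj H1 cH]] := def _ (cube_retract_itv R) _ cg.
  have slice t0 z : j z = g t0 -> exists2 z', j z' = H (itv_clamp 1) (j z) &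
      joined R z z'.
    move=> zg; have [||a ca aE] := lift I (fun t => H t (g t0)) (cube_retract_itv R).
    + apply: (@comp_cont _ _ _ (fun t => (t, t0)) _) cH.
      by apply: pair_cont; [exact: id_cont|exact: cst_cont].
    + by move=> t; rewrite -zg.
    exists (a (itv_clamp 1)); first by rewrite aE zg.
    apply/joinedP; exists a; split => //.
    by apply: jI; rewrite aE H0.
  have [z zE xz] := slice _ _ (esym g0); have [z' z'E xz'] := slice _ _ (esym g1).
  apply: joined_trans xz _; apply: joined_trans (joined_sym xz').
  have [||a ca aE] := lift I (fun t => H (itv_clamp 1) (g t)) (cube_retract_itv R).
  + apply: (@comp_cont _ _ _ (fun t => (itv_clamp 1, t)) _) cH.
    by apply: pair_cont; [exact: cst_cont|exact: id_cont].
  + exact: H1.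
  by apply/joinedP; exists a; split => //; apply: jI;
    rewrite aE ?g0 ?g1 ?zE ?z'E.
- move=> n x0 b sb; have [cb bb] := sb.
  have [H [H0 Hj H1 cH]] := def _ (cube_retract_cube R n.+1) _ cb.
  pose K (sc : I * @cube R n.+1) :=
    H (itv_clamp (\val sc.1 * \val (ramp sc.2))) (b (expand 0 sc.2)).
  have cK : continuous K.
    apply: (@comp_cont _ _ _ (fun sc : I * @cube R n.+1 =>
      (itv_clamp (\val sc.1 * \val (ramp sc.2)), expand 0 sc.2))
      (fun tq => H tq.1 (b tq.2))) cH.
    apply: pair_cont; last first.
      by apply: expand_cont; [exact: cst_cont|exact: snd_cont].
    apply: itv_clamp_cont; apply: contM.
      exact: (comp_cont (@fst_cont _ _) (@itv_val_cont R)).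
    apply: (comp_cont _ (@itv_val_cont R)).
    by apply: ramp_cont; exact: snd_cont.
  have Kb t c : cube_boundary c -> K (t, c) = j x0.
    move=> bc; rewrite /K [snd _]/= ramp_boundary // [\val (itv_clamp 0)]itv_clamp0 //.
    by rewrite mulr0 H0 bb //; exact: expand_boundary.
  have K1 c : K (itv_clamp 1, c) = H (ramp c) (b (expand 0 c)).
    by rewrite /K [fst _]/= [\val (itv_clamp 1)]itv_clamp1 // mul1r itv_clampK.
  have [||a ca aE] := lift _ (fun c => K (itv_clamp 1, c)) (cube_retract_cube R n.+1).
  + by apply: comp_cont cK; apply: pair_cont; [exact: cst_cont|exact: id_cont].
  + move=> c; rewrite K1; case: (leP (cube_depth c) 4^-1) => dc.
      by rewrite bb //; exact: expand_collar.
    by rewrite ramp_inner //; exact: ltW.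
  exists a; first by split => // c bc; apply: jI; rewrite aE Kb.
  apply: homotopic_trans (homotopic_expand sb); apply: homotopic_sym.
  apply/homotopicP; exists K; split => // c; last by rewrite /= aE.
  by rewrite /K [fst _]/= [\val (itv_clamp 0)]itv_clamp0 // mul0r H0.
- move=> n x0 a a' [ca ba] [ca' ba'] /homotopicP[G [cG G0 G1 Gb]].
  have [H [H0 Hj H1 cH]] := def _ (cube_retract_prism R n.+1) _ cG.
  have ends t0 (e : @cube R n.+1 -> A) : spheroid x0 e ->
      (forall c, G (t0, c) = j (e c)) ->
      exists2 e', homotopic_rel x0 e e' &
      forall c, j (e' c) = H (ramp c) (G (t0, expand 0 c)).
    move=> se eG; have [ce be] := se.
    pose K (sc : I * @cube R n.+1) :=
      H (itv_clamp (\val sc.1 * \val (ramp sc.2))) (G (t0, expand 0 sc.2)).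
    have [||k ck kE] := lift _ K (cube_retract_prism R n.+1).
    + apply: (@comp_cont _ _ _ (fun sc : I * @cube R n.+1 =>
        (itv_clamp (\val sc.1 * \val (ramp sc.2)), (t0, expand 0 sc.2)))
        (fun tq => H tq.1 (G tq.2))) cH.
      apply: pair_cont; last apply: pair_cont; first last.
      * by apply: expand_cont; [exact: cst_cont|exact: snd_cont].
      * exact: cst_cont.
      apply: itv_clamp_cont; apply: contM.
        exact: (comp_cont (@fst_cont _ _) (@itv_val_cont R)).
      apply: (comp_cont _ (@itv_val_cont R)).
      by apply: ramp_cont; exact: snd_cont.
    + by move=> sc; rewrite /K eG.
    exists (fun c => k (itv_clamp 1, c)); last first.
      by move=> c; rewrite kE /K [fst _]/= [\val (itv_clamp 1)]itv_clamp1 // mul1r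
        itv_clampK.
    apply: homotopic_trans (homotopic_sym (homotopic_expand se)) _.
    apply/homotopicP; exists k; split => //.
    + move=> c; apply: jI; rewrite kE /K [fst _]/= [\val (itv_clamp 0)]itv_clamp0 //.
      by rewrite mul0r H0 eG.
    + move=> t c bc; apply: jI; rewrite kE /K [snd _]/= ramp_boundary //.
      rewrite [\val (itv_clamp 0)]itv_clamp0 // mulr0 H0 eG be //.
      exact: expand_boundary.
  have [e ae eE] := ends _ _ (conj ca ba) G0.
  have [e' ae' e'E] := ends _ _ (conj ca' ba') G1.
  apply: homotopic_trans ae _; apply: homotopic_trans (homotopic_sym ae').
  have [||k ck kE] := lift _ (fun tc : I * @cube R n.+1 =>
    H (ramp tc.2) (G (tc.1, expand 0 tc.2))) (cube_retract_prism R n.+1).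
  + apply: (@comp_cont _ _ _ (fun tc : I * @cube R n.+1 =>
      (ramp tc.2, (tc.1, expand 0 tc.2))) (fun tq => H tq.1 (G tq.2))) cH.
    apply: pair_cont; first by apply: ramp_cont; exact: snd_cont.
    apply: pair_cont; first exact: fst_cont.
    by apply: expand_cont; [exact: cst_cont|exact: snd_cont].
  + move=> [t c] /=; case: (leP (cube_depth c) 4^-1) => dc.
      by rewrite Gb; [exact: Hj|exact: expand_collar].
    by rewrite ramp_inner; [exact: (H1 (t, _))|exact: ltW].
  apply/homotopicP; exists k; split => //.
  + by move=> c; apply: jI; rewrite kE eE.
  + by move=> c; apply: jI; rewrite kE e'E.
  + move=> t c bc; apply: jI; rewrite kE /= ramp_boundary // H0 Gb //.
    exact: expand_boundary.
Qed.

End Sources.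

(** * Simplices as test spaces *)

Section Compactness.

Lemma compact_subtype (T : topologicalType) (A : set T) :
  compact A -> compact [set: A].
Proof.
move=> cA F FF _.
have FA : (set_val @ F) A.
  by rewrite /fmap /=; apply: filterE => a; exact: set_valP.
have [x [Ax clx]] := cA _ (fmap_proper_filter set_val FF) FA.
exists (exist (fun y => y \in A) x (mem_set Ax)); split => // B C FB.
rewrite nbhsE => -[D [[V oV VD] Dx] DC].
have FV : (set_val @ F) (set_val @` B).
  by rewrite /fmap /=; apply: filterS FB => b Bb; exists b.
have Vx : nbhs x V.
  by apply: open_nbhs_nbhs; split => //; move: Dx; rewrite -VD.
have [y [[b Bb by_] Vy]] := clx _ _ FV Vx.
by exists b; split => //; apply: DC; rewrite -VD /= by_.
Qed.

Lemma hausdorff_subtype (T : topologicalType) (A : set T) :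
  hausdorff_space T -> hausdorff_space A.
Proof.
move=> hT x y clxy; apply: val_inj; apply: hT => B C nB nC.
have [z [Bz Cz]] := clxy _ _ (@val_cont _ A _ _ nB) (@val_cont _ A _ _ nC).
by exists (set_val z).
Qed.

Context (R : realType).

Lemma compact_cube n : compact [set: @cube R n].
Proof.
apply: compact_subtype.
have := @rV_compact R n (fun=> `[0, 1]%classic) (fun=> @segment_compact R 0 1).
by congr compact; apply/seteqP; split=> x /= xP i; have := xP i;
  rewrite /= in_itv.
Qed.

Lemma compact_std_simplex n : compact [set: std_simplex R n].
Proof.
apply: compact_subtype.
apply: (@subclosed_compact _ _ [set v : 'rV[R]_n.+1 | forall i, `[0, 1]%classic (v ord0 i)]).
- rewrite (_ : std_simplex R n =
    (\bigcap_i [set x : 'rV[R]_n.+1 | 0 <= x ord0 i]) `&`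
    [set x | \sum_i x ord0 i = 1]); last first.
    by apply/seteqP; split=> x [x0 x1]; split => // i; [move=> _|]; exact: x0.
  apply: closedI.
    apply: closed_bigI => i _.
    apply: (@preimage_closed _ _ (fun x : 'rV[R]_n.+1 => x ord0 i)
      [set r | 0 <= r]); last exact: closed_ge.
    by move=> x _; exact: coord_continuous.
  apply: (@preimage_closed _ _ (fun x : 'rV[R]_n.+1 => \sum_i x ord0 i) [set 1]).
    by move=> x _; apply: cont_sum => j; exact: coord_continuous.
  exact: closed_eq.
- exact: (@rV_compact R n.+1 (fun=> `[0, 1]%classic) (fun=> @segment_compact R 0 1)).
- move=> x [x0 x1] i /=; rewrite in_itv /= x0 -x1 (bigD1 i) //= lerDl.
  by apply: sumr_ge0.
Qed.

Lemma hausdorff_std_simplex n : hausdorff_space (std_simplex R n).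
Proof. by apply: hausdorff_subtype; exact: norm_hausdorff. Qed.

End Compactness.

Section InTop.
Context (R : realType) (k : space_kind).

Definition in_Top (Z : topologicalType) : Prop :=
  forall U : set Z, test_open R k U -> open U.

Lemma in_Top_retract (Z W : topologicalType) (i : Z -> W) (r : W -> Z) :
  continuous i -> continuous r -> cancel i r -> in_Top W -> in_Top Z.
Proof.
move=> ci cr iK WT U /(test_open_comp cr)/WT oU.
rewrite (_ : U = i @^-1` (r @^-1` U)); first by move/continuousP: ci; exact.
by apply/seteqP; split=> z /=; rewrite iK.
Qed.

(** A simplex is its own test space, whichever the kind of spaces. *)
Lemma in_Top_std_simplex n : in_Top (std_simplex R n).
Proof.
rewrite /in_Top; case: k => //= U oU.
  exact: (oU _ (@compact_std_simplex R n) (@hausdorff_std_simplex R n) _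
    (@id_cont _)).
exact: (oU n _ (@id_cont _)).
Qed.

End InTop.

Section SimplexBasics.
Context (R : realType) (d : Order.disp_t) (P : porderType d).
Implicit Type J : flag P.

Definition simplex_of J (v : 'I_(flag_dim J).+1 -> R)
    (vP : (forall i, 0 <= v i) /\ \sum_i v i = 1) : simplex R J.
Proof.
exists (\row_i v i); apply: mem_set; case: vP => v0 v1.
by split=> [i|]; [rewrite mxE|rewrite -v1; apply: eq_bigr => i _; rewrite mxE].
Defined.

Lemma simplex_ofE J v vP i : barycentric (@simplex_of J v vP) i = v i.
Proof. by rewrite /barycentric /= mxE. Qed.

Lemma barycentric_cont J (Z : topologicalType) (f : Z -> simplex R J) i :
  continuous f -> continuous (fun z => barycentric (f z) i).
Proof. exact: coord_cont. Qed.

Lemma simplex_cont J (Z : topologicalType) (f : Z -> simplex R J) :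
  (forall i, continuous (fun z => barycentric (f z) i)) -> continuous f.
Proof. exact: subrow_cont. Qed.

Lemma barycentric_gt0 J (x : simplex R J) i :
  (0 < barycentric x i) = (barycentric x i != 0).
Proof. by rewrite lt0r barycentric_ge0 andbT. Qed.

End SimplexBasics.

(** The product of a cube and the simplex of [J] is a retract over the poset of the
    simplex of a longer flag: the head of [J], which is its least vertex, is
    repeated once for each coordinate of the cube. *)
Section Prism.
Context (R : realType) (d : Order.disp_t) (P : porderType d).
Context (J : flag P) (m : nat).
Let p0 := flag_head J.

Lemma prism_flagP : path <=%O p0 (nseq m p0 ++ flag_tail J).
Proof. by elim: m => [|n IH] /=; [exact: flagP|rewrite lexx]. Qed.

Definition prism_flag : flag P := Flag prism_flagP.

Lemma prism_dim : (m + (flag_dim J).+1)%N = (flag_dim prism_flag).+1.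
Proof. by rewrite /flag_dim /= size_cat size_nseq addnS. Qed.

Definition prism_index (l : 'I_(m + (flag_dim J).+1)) := cast_ord prism_dim l.

Lemma prism_seq : (prism_flag : seq P) = nseq m p0 ++ J.
Proof. by rewrite /flag_seq /=; elim: m => //= n ->. Qed.

Lemma prism_vertexl a : flag_vertex (prism_index (lshift _ a)) = p0.
Proof.
by rewrite /flag_vertex prism_seq nth_cat /= size_nseq ltn_ord nth_nseq ltn_ord.
Qed.

Lemma prism_vertexr i : flag_vertex (prism_index (rshift _ i)) = flag_vertex i.
Proof.
rewrite /flag_vertex prism_seq nth_cat /= size_nseq ltnNge leq_addr /=.
by rewrite addKn.
Qed.

Lemma prism_sum (F : 'I_(flag_dim prism_flag).+1 -> R) : \sum_l F l =
  \sum_a F (prism_index (lshift _ a)) + \sum_i F (prism_index (rshift _ i)).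
Proof.
rewrite (reindex prism_index) /=; first by rewrite big_split_ord.
by exists (cast_ord (esym prism_dim)) => l _; [exact: cast_ordK|exact: cast_ordKV].
Qed.

Lemma prism_indexP l : (exists a, l = prism_index (lshift _ a)) \/
  (exists i, l = prism_index (rshift _ i)).
Proof.
rewrite -[l](cast_ordKV prism_dim).
by case: (split_ordP (cast_ord (esym prism_dim) l)) => i ->; [left|right]; exists i.
Qed.

(* The cube uses at most half of the total mass. *)
Let s : R := 2^-1 / m.+1%:R.

Let s_gt0 : 0 < s. Proof. by apply: divr_gt0; rewrite ?invr_gt0 ltr0n. Qed.

Let cube_mass (q : @cube R m) : R := \sum_a s * cube_coord q a.

Let cube_mass_le q : cube_mass q <= 2^-1.
Proof.
apply: (@le_trans _ _ (\sum_(a < m) s)).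
  apply: ler_sum => a _; have /andP[_ q1] := cube_coordP q a.
  by rewrite ler_piMr // ltW.
rewrite sumr_const card_ord -[s *+ m]mulr_natr /s -mulrA ler_piMr ?invr_ge0 ?ler0n //.
by rewrite mulrC ler_pdivrMr // mul1r ler_nat.
Qed.

Definition prism_section_val (qx : @cube R m * simplex R J) l : R :=
  match fintype.split (cast_ord (esym prism_dim) l) with
  | inl a => s * cube_coord qx.1 a
  | inr i => (1 - cube_mass qx.1) * barycentric qx.2 i
  end.

Lemma prism_section_vall qx a :
  prism_section_val qx (prism_index (lshift _ a)) = s * cube_coord qx.1 a.
Proof. by rewrite /prism_section_val cast_ordK (unsplitK (inl a)). Qed.

Lemma prism_section_valr qx i : prism_section_val qx (prism_index (rshift _ i)) =
  (1 - cube_mass qx.1) * barycentric qx.2 i.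
Proof. by rewrite /prism_section_val cast_ordK (unsplitK (inr i)). Qed.

Lemma prism_section_valP qx : (forall l, 0 <= prism_section_val qx l) /\
  \sum_l prism_section_val qx l = 1.
Proof.
split=> [l|].
  case: (prism_indexP l) => -[i ->].
    rewrite prism_section_vall mulr_ge0 //; first exact: ltW.
    by have /andP[] := cube_coordP qx.1 i.
  rewrite prism_section_valr mulr_ge0 ?barycentric_ge0 //.
  by have := cube_mass_le qx.1; lra.
rewrite prism_sum; under eq_bigr do rewrite prism_section_vall.
under [X in _ + X]eq_bigr do rewrite prism_section_valr.
by rewrite -[X in _ + X]mulr_sumr barycentric_sum mulr1 addrC subrK.
Qed.

Definition prism_section qx : simplex R prism_flag :=
  simplex_of (prism_section_valP qx).

(* On the image of the section the simplex has at least half of the mass. Elsewhere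
   the mass that is missing to one half is put on the head of the flag, so that the
   normalization stays continuous. *)
Let simplex_mass (w : simplex R prism_flag) : R :=
  \sum_i barycentric w (prism_index (rshift _ i)).

Let mass_max w := Num.max (simplex_mass w) 2^-1.

Let mass_max_gt0 w : 0 < mass_max w.
Proof. by rewrite /mass_max lt_max invr_gt0 ltr0n orbT. Qed.

Definition prism_retract_val w i : R :=
  (barycentric w (prism_index (rshift _ i)) +
   (i == ord0)%:R * (mass_max w - simplex_mass w)) / mass_max w.

Lemma prism_retract_valP w : (forall i, 0 <= prism_retract_val w i) /\
  \sum_i prism_retract_val w i = 1.
Proof.
split=> [i|].
  rewrite divr_ge0 ?(ltW (mass_max_gt0 w)) // addr_ge0 ?barycentric_ge0 //.
  by rewrite mulr_ge0 ?ler0n // subr_ge0 /mass_max le_max lexx.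
rewrite -mulr_suml big_split /= -/(simplex_mass w) -mulr_suml.
rewrite (bigD1 ord0) //= big1 => [|i /negbTE -> //].
by rewrite addr0 mul1r addrC subrK divff // gt_eqF.
Qed.

Definition prism_retract w : @cube R m * simplex R J :=
  (cube_clamp (fun a => s^-1 * barycentric w (prism_index (lshift _ a))),
   simplex_of (prism_retract_valP w)).

Lemma prism_sectionK : cancel prism_section prism_retract.
Proof.
move=> [q x]; congr pair.
  rewrite -[RHS]cube_clampK; congr cube_clamp; apply/funext => a.
  by rewrite simplex_ofE prism_section_vall mulrA mulVf ?mul1r // gt_eqF.
have sE : simplex_mass (prism_section (q, x)) = 1 - cube_mass q.
  rewrite /simplex_mass; under eq_bigr do rewrite simplex_ofE prism_section_valr.
  by rewrite -mulr_sumr barycentric_sum mulr1.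
have mE : mass_max (prism_section (q, x)) = 1 - cube_mass q.
  by rewrite /mass_max sE max_l //; have := cube_mass_le q; lra.
apply: barycentric_inj => i; rewrite simplex_ofE /prism_retract_val.
rewrite simplex_ofE prism_section_valr mE sE subrr mulr0 addr0 mulrC mulKf //.
by have := cube_mass_le q; move=> ?; apply/eqP; lra.
Qed.

Lemma prism_section_cont : continuous prism_section.
Proof.
have cy a : continuous (fun qx : @cube R m * simplex R J => s * cube_coord qx.1 a).
  apply: contM; first exact: cst_cont.
  by apply: cube_coord_cont; exact: fst_cont.
apply: simplex_cont => l.
apply: (eq_cont (fun qx => simplex_ofE (prism_section_valP qx) l)).
case: (prism_indexP l) => -[i ->].
  exact: eq_cont (prism_section_vall ^~ i) (cy i).
apply: (eq_cont (prism_section_valr ^~ i)).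
apply: contM; last by apply: barycentric_cont; exact: snd_cont.
by apply: contB; [exact: cst_cont|apply: cont_sum].
Qed.

Lemma prism_retract_cont : continuous prism_retract.
Proof.
have cb l : continuous (fun w : simplex R prism_flag => barycentric w l).
  by apply: barycentric_cont; exact: id_cont.
have csm : continuous simplex_mass by apply: cont_sum.
have cmm : continuous mass_max by apply: cont_max => //; exact: cst_cont.
apply: pair_cont.
  by apply: cube_clamp_cont => a; apply: contM => //; exact: cst_cont.
apply: simplex_cont => i.
apply: (eq_cont (fun w => simplex_ofE (prism_retract_valP w) i)).
apply: contM; last by apply: contV => // w; rewrite gt_eqF.
apply: contD => //; apply: contM; first exact: cst_cont.
exact: contB.
Qed.

(** Mass may be moved onto the head of the flag, which is its least vertex. *)
Lemma prism_retract_strat w :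
  simplex_strat (prism_retract w).2 = simplex_strat w.
Proof.
apply/esym/simplex_stratP.
have [[i xi iE] xmax] := (simplex_stratP (prism_retract w).2 _).1 erefl.
set p := simplex_strat _ in iE xmax *.
have p0p : (p0 <= p)%O.
  by rewrite -iE; apply: (@flag_vertex_le _ _ J ord0 i).
have wmax l : 0 < barycentric w l -> (flag_vertex l <= p)%O.
  case: (prism_indexP l) => -[j ->]; first by rewrite prism_vertexl.
  rewrite prism_vertexr => wj; apply: xmax; rewrite simplex_ofE.
  rewrite divr_gt0 // ltr_wpDr // mulr_ge0 ?ler0n // subr_ge0.
  by rewrite /mass_max le_max lexx.
split => //; have [wi|] := ltP 0 (barycentric w (prism_index (rshift _ i))).
  by exists (prism_index (rshift _ i)) => //; rewrite prism_vertexr.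
move=> wi; have i0 : i = ord0.
  apply/eqP; apply: contraT => /negbTE i0; move: xi.
  rewrite simplex_ofE /prism_retract_val i0 mul0r addr0 ltNge.
  by rewrite mulr_le0_ge0 // invr_ge0 ltW.
have [l wl] := barycentric_supp w; exists l => //.
apply: le_anti; rewrite wmax //= -iE i0; apply: le_trans (_ : (p0 <= _)%O).
  by rewrite /flag_vertex.
case: (prism_indexP l) => -[j ->]; first by rewrite prism_vertexl.
by rewrite prism_vertexr; apply: (@flag_vertex_le _ _ J ord0 j).
Qed.

(** In the definition of a neighbourhood of a stratum, the test simplices may be
    replaced by simplices with parameters. *)
Lemma Delta_neighborhood_prism (k : space_kind) (X : strat_space R k P)
    (S U : set X) (f : @cube R m * simplex R J -> X) :
  Delta_neighborhood S U -> continuous f ->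
  (forall qx, strat (f qx) = simplex_strat qx.2) ->
  set_nbhs (f @^-1` S) (f @^-1` U).
Proof.
move=> SU cf sf qx Sqx.
have fP : simplex_map (J := prism_flag) (f \o prism_retract).
  split=> [|w]; first exact: comp_cont prism_retract_cont cf.
  by rewrite /= sf prism_retract_strat.
have := SU prism_flag _ fP (prism_section qx).
rewrite /= prism_sectionK => /(_ Sqx)/prism_section_cont.
by apply: (@filterS _ (nbhs qx) (nbhs_filter qx)) => qx' /=; rewrite prism_sectionK.
Qed.

Lemma in_Top_prism k : in_Top R k (@cube R m * simplex R J)%type.
Proof.
apply: (in_Top_retract prism_section_cont prism_retract_cont prism_sectionK).
exact: in_Top_std_simplex.
Qed.

End Prism.

(** * Pushing a simplex into neighbourhoods of its strata *)

Section Depth.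
Context (R : realType) (d : Order.disp_t) (P : porderType d) (J : flag P).
Implicit Types (x y z : simplex R J) (W : set (simplex R J)).

Definition simplex_dist x y : R := \sum_i `|barycentric x i - barycentric y i|.

Lemma simplex_dist_ge0 x y : 0 <= simplex_dist x y.
Proof. by apply: sumr_ge0 => i _; exact: normr_ge0. Qed.

Lemma simplex_dist_triangle x y z :
  simplex_dist x z <= simplex_dist x y + simplex_dist y z.
Proof. by rewrite -big_split; apply: ler_sum => i _; exact: ler_distD. Qed.

Lemma simplex_distC x y : simplex_dist x y = simplex_dist y x.
Proof. by apply: eq_bigr => i _; exact: distrC. Qed.

Lemma simplex_dist_cont x : continuous (simplex_dist x).
Proof.
apply: cont_sum => i; apply: (comp_cont _ (@norm_continuous _ R)).
apply: contB; first exact: cst_cont.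
by apply: barycentric_cont; exact: id_cont.
Qed.

Lemma simplex_dist_nbhs x W : nbhs x W ->
  exists2 e : R, 0 < e & forall y, simplex_dist x y < e -> W y.
Proof.
rewrite nbhsE => -[_ [[V oV <-] Vx] VW].
have /nbhs_ballP[e e0 eV] : nbhs (set_val x) V by exact: open_nbhs_nbhs.
exists e => // y xy; apply: VW; apply: eV; split=> // i j.
rewrite ord1 /ball /=; apply: le_lt_trans xy; rewrite /simplex_dist.
rewrite (bigD1 j) //= lerDl; apply: sumr_ge0 => l _; exact: normr_ge0.
Qed.

(** The distance to the complement of [W], cut off at one so that it is positive
    when the complement is empty. *)
Definition depth W x : R := inf (1 |` [set simplex_dist x y | y in ~` W]).

Let depth_has_lbound W x :
  has_lbound (1 |` [set simplex_dist x y | y in ~` W]).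
Proof.
by exists 0 => r [->|[y _ <-]]; [exact: ler01|exact: simplex_dist_ge0].
Qed.

Lemma depth_le1 W x : depth W x <= 1.
Proof. by apply: ge_inf => //; left. Qed.

Lemma depth_ge W x e : e <= 1 -> (forall y, ~ W y -> e <= simplex_dist x y) ->
  e <= depth W x.
Proof.
move=> e1 eW; apply: lb_le_inf; first by exists 1; left.
by move=> r [->//|[y Wy <-]]; exact: eW.
Qed.

Lemma depth_ge0 W x : 0 <= depth W x.
Proof. by apply: depth_ge => // y _; exact: simplex_dist_ge0. Qed.

Lemma depth_gt0 W x : nbhs x W -> 0 < depth W x.
Proof.
move=> /simplex_dist_nbhs[e e0 eW].
apply: (@lt_le_trans _ _ (Num.min e 1)); first by rewrite lt_min e0 ltr01.
apply: depth_ge => [|y Wy]; first by rewrite ge_min lexx orbT.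
by rewrite ge_min leNgt; apply/orP; left; apply/negP => /eW.
Qed.

Lemma depthP W x y : simplex_dist x y < depth W x -> W y.
Proof.
move=> xy; apply: contrapT => Wy; move: xy; apply/negP; rewrite -leNgt.
by apply: ge_inf => //; right; exists y.
Qed.

Lemma depth_lipschitz W x y : depth W x - simplex_dist x y <= depth W y.
Proof.
apply: depth_ge => [|z Wz].
  by rewrite lerBlDr (le_trans (depth_le1 W x)) // lerDl simplex_dist_ge0.
rewrite lerBlDr addrC; apply: le_trans (simplex_dist_triangle x y z).
by apply: ge_inf => //; right; exists z.
Qed.

Lemma depth_cont W : continuous (depth W).
Proof.
move=> x; have FF := nbhs_filter x; apply/cvgrPdist_le => e e0.
have : \forall y \near x, simplex_dist x y < e.
  have dxx : simplex_dist x x = 0.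
    by apply: big1 => i _; rewrite subrr normr0.
  have := @simplex_dist_cont x x [set r | r < e].
  by apply; rewrite dxx; apply: open_nbhs_nbhs; split => //; exact: open_lt.
apply: filterS => y xy.
have := depth_lipschitz W x y; have := depth_lipschitz W y x.
by rewrite (simplex_distC y) ler_norml => *; apply/andP; split; lra.
Qed.

End Depth.

Section Push.
Context (R : realType) (d : Order.disp_t) (P : porderType d).
Context (I : regular_flag P).
Local Notation It := (@unit_itv R).
Local Notation D := (simplex R I).
Implicit Types (x y : D) (i j l : 'I_(flag_dim I).+1) (t : It).

Lemma flag_vertex_leE i j : (flag_vertex i <= flag_vertex j)%O = (i <= j)%N.
Proof.
apply/idP/idP; last exact: flag_vertex_le.
move=> ij; rewrite leqNgt; apply/negP => ji.
have e : flag_vertex i = flag_vertex j.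
  by apply/le_anti; rewrite ij flag_vertex_le // ltnW.
by move: ji; rewrite (flag_vertex_inj e) ltnn.
Qed.

Lemma simplex_strat_vertex x i : simplex_strat x = flag_vertex i <->
  0 < barycentric x i /\ forall j, (i < j)%N -> barycentric x j = 0.
Proof.
split=> [/simplex_stratP[[j xj /flag_vertex_inj <-] jmax]|[xi x0]].
  split => // l jl; apply/eqP; apply: contraT; rewrite -barycentric_gt0.
  by move=> /jmax; rewrite flag_vertex_leE leqNgt jl.
apply/simplex_stratP; split=> [|j xj]; first by exists i.
rewrite flag_vertex_leE leqNgt; apply/negP => /x0 x0j.
by rewrite x0j ltxx in xj.
Qed.

Lemma simplex_strat_exists x : exists i, simplex_strat x = flag_vertex i.
Proof.
by have [[i _ <-] _] := (simplex_stratP x _).1 erefl; exists i.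
Qed.

Definition tail_mass i x : R := \sum_(j : 'I_(flag_dim I).+1 | (i < j)%N) barycentric x j.

Lemma tail_mass_ge0 i x : 0 <= tail_mass i x.
Proof. by apply: sumr_ge0 => j _; exact: barycentric_ge0. Qed.

Lemma tail_mass_eq0 i x : tail_mass i x = 0 ->
  forall j, (i < j)%N -> barycentric x j = 0.
Proof.
move=> t0 j ij; apply: (psumr_eq0P _ t0) => // l _; exact: barycentric_ge0.
Qed.

Lemma tail_mass_le1 i x : tail_mass i x <= 1.
Proof.
rewrite -(barycentric_sum x) [leRHS](bigID (fun j : 'I_(flag_dim I).+1 => (i < j)%N)) /= lerDl.
by apply: sumr_ge0 => j _; exact: barycentric_ge0.
Qed.

(** The weights after the vertex [i] are multiplied by the parameter, and the mass
    that they lose goes to [i]. At the parameter 0 this is a retraction onto the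
    face spanned by the vertices up to [i]. *)
Definition push_val i (tx : It * D) j : R :=
  (if (i < j)%N then \val tx.1 else 1) * barycentric tx.2 j +
  (j == i)%:R * ((1 - \val tx.1) * tail_mass i tx.2).

Lemma push_valP i tx :
  (forall j, 0 <= push_val i tx j) /\ \sum_j push_val i tx j = 1.
Proof.
case: tx => t x; have /andP[t0 t1] := itvP t; split=> [j|].
  rewrite /push_val /= addr_ge0 //.
    by rewrite mulr_ge0 ?barycentric_ge0 //; case: ifP.
  by rewrite !mulr_ge0 ?ler0n ?subr_ge0 ?tail_mass_ge0.
have tailE : \sum_(j : 'I_(flag_dim I).+1 | ~~ (i < j)%N) barycentric x j = 1 - tail_mass i x.
  have := barycentric_sum x.
  rewrite (bigID (fun j : 'I_(flag_dim I).+1 => (i < j)%N)) /= => <-.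
  by rewrite /tail_mass [RHS]addrC addrA addNr add0r.
rewrite big_split /= [X in _ + X](bigD1 i) //= eqxx mul1r.
rewrite [X in _ + (_ + X)]big1 => [|j /negbTE ->]; last by rewrite mul0r.
rewrite addr0 (bigID (fun j : 'I_(flag_dim I).+1 => (i < j)%N)) /=.
under eq_bigr => j ij do rewrite ij.
under [X in _ + X + _]eq_bigr => j ij do rewrite (negbTE ij) mul1r.
by rewrite -mulr_sumr tailE -/(tail_mass i x); ring.
Qed.

Definition push i (tx : It * D) : D := simplex_of (push_valP i tx).

Lemma pushE i tx j : barycentric (push i tx) j = push_val i tx j.
Proof. exact: simplex_ofE. Qed.

Lemma push_cont i : continuous (push i).
Proof.
apply: simplex_cont => j; apply: (eq_cont (fun tx => pushE i tx j)).
have ct : continuous (fun tx : It * D => \val tx.1 : R).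
  exact: (comp_cont (@fst_cont _ _) (@itv_val_cont R)).
have cx l : continuous (fun tx : It * D => barycentric tx.2 l).
  by apply: barycentric_cont; exact: snd_cont.
apply: contD; apply: contM => //; last apply: contM.
- by case: (i < j)%N; [exact: ct|exact: cst_cont].
- exact: cst_cont.
- by apply: contB => //; exact: cst_cont.
- exact: cont_sum.
Qed.

Lemma push1 i x : push i (itv_clamp 1, x) = x.
Proof.
apply: barycentric_inj => j; rewrite pushE /push_val [fst _]/= itv_clamp1 //.
by rewrite subrr mul0r mulr0 addr0 if_same mul1r.
Qed.

Lemma push_tail0 i t x : tail_mass i x = 0 -> push i (t, x) = x.
Proof.
move=> x0; apply: barycentric_inj => j; rewrite pushE /push_val /= x0.
rewrite !mulr0 addr0; case: ifPn => [ij|]; last by rewrite mul1r.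
by rewrite (tail_mass_eq0 x0 ij) mulr0.
Qed.

Lemma push_strat i t x : (0 < tail_mass i x -> 0 < \val t) ->
  simplex_strat (push i (t, x)) = simplex_strat x.
Proof.
move=> t0; have [tail0|] := eqVneq (tail_mass i x) 0; first by rewrite push_tail0.
rewrite neq_lt ltNge tail_mass_ge0 /= => tail0; have {}t0 := t0 tail0.
have [l lx] := simplex_strat_exists x; rewrite lx.
have [xl x0] := (simplex_strat_vertex x l).1 lx.
have il : (i < l)%N.
  rewrite ltnNge; apply/negP => li; move: tail0; rewrite /tail_mass big1 ?ltxx //.
  by move=> j ij; apply: x0; exact: leq_ltn_trans ij.
have ne j : (i < j)%N -> (j == i) = false.
  by move=> ij; apply/eqP => ji; rewrite ji ltnn in ij.
apply/simplex_strat_vertex; split=> [|j lj]; rewrite pushE /push_val /=.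
  by rewrite il ne // mul0r addr0 mulr_gt0.
have ij := ltn_trans il lj.
by rewrite ij ne // mul0r addr0 x0 // mulr0.
Qed.

Lemma push0_strat i x : 0 < tail_mass i x ->
  simplex_strat (push i (itv_clamp 0, x)) = flag_vertex i.
Proof.
move=> tail0; apply/simplex_strat_vertex; rewrite pushE /push_val [fst _]/=.
rewrite itv_clamp0 // ltnn eqxx !mul1r subr0 mul1r; split.
  by rewrite ltr_wpDl // barycentric_ge0.
move=> j ij; rewrite pushE /push_val [fst _]/= itv_clamp0 // ij.
have -> : (j == i) = false by apply/eqP => ji; rewrite ji ltnn in ij.
by rewrite !mul0r addr0.
Qed.

Lemma push_dist i t x :
  simplex_dist (push i (itv_clamp 0, x)) (push i (t, x)) <= 2 * \val t.
Proof.
have /andP[t0 t1] := itvP t.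
have tail0 := tail_mass_ge0 i x; have tail1 := tail_mass_le1 i x.
rewrite /simplex_dist (bigID (fun j : 'I_(flag_dim I).+1 => (i < j)%N)) /=.
have -> : \sum_(j : 'I_(flag_dim I).+1 | (i < j)%N) `|barycentric (push i (itv_clamp 0, x)) j -
    barycentric (push i (t, x)) j| = \val t * tail_mass i x.
  rewrite mulr_sumr; apply: eq_bigr => j ij.
  rewrite !pushE /push_val ij; cbn [fst snd]; rewrite itv_clamp0 // mul0r add0r.
  have -> : (j == i) = false by apply/eqP => ji; rewrite ji ltnn in ij.
  rewrite !mul0r addr0 sub0r normrN ger0_norm //.
  by rewrite mulr_ge0 // barycentric_ge0.
rewrite (bigD1 i) ?ltnn //= big1 ?addr0 => [|j /andP[/negbTE ij /negbTE ji]].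
  rewrite !pushE /push_val ltnn eqxx; cbn [fst snd]; rewrite itv_clamp0 // !mul1r.
  have -> : barycentric x i + (1 - 0) * tail_mass i x -
    (barycentric x i + (1 - \val t) * tail_mass i x) = \val t * tail_mass i x.
    by ring.
  rewrite ger0_norm ?mulr_ge0 //.
  have tt : \val t * tail_mass i x <= \val t by rewrite ler_piMr.
  by change (\val t * tail_mass i x + \val t * tail_mass i x <= 2 * \val t); lra.
by rewrite !pushE /push_val ij ji !mul0r !addr0 subrr normr0.
Qed.

(** Pushing along the vertex [i] keeps the vertices after [i] in play, but with a
    weight small enough, compared with the distance from the open stratum to the
    complement of [W], for the image to land in [W]. *)
Lemma shrink_into_vertex i (W : set D) :
  (forall x, simplex_strat x = flag_vertex i -> nbhs x W) ->
  (forall x, (simplex_strat x <= flag_vertex i)%O -> W x) ->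
  exists phi : It * D -> D, [/\ continuous phi,
    forall x, phi (itv_clamp 0, x) = x,
    forall tx, simplex_strat (phi tx) = simplex_strat tx.2 &
    forall x, W (phi (itv_clamp 1, x))].
Proof.
move=> nW leW.
(* By [push_dist] a push by [lam x] covers at most half of the depth. *)
pose lam x : R := 4^-1 * depth W (push i (itv_clamp 0, x)).
have l_ge0 x : 0 <= lam x by apply: mulr_ge0; [rewrite invr_ge0|exact: depth_ge0].
have l_le1 x : lam x <= 1.
  by have := depth_le1 W (push i (itv_clamp 0, x)); rewrite /lam; lra.
have l_gt0 x : 0 < tail_mass i x -> 0 < lam x.
  move=> x0; apply: mulr_gt0; first by rewrite invr_gt0.
  by apply: depth_gt0; apply: nW; exact: push0_strat.
pose w (tx : It * D) : R := (1 - \val tx.1) + \val tx.1 * lam tx.2.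
have wP tx : 0 <= w tx <= 1.
  case: tx => t x; rewrite /w; cbn [fst snd]; have := itvP t.
  have := l_ge0 x; have := l_le1 x; set u := \val t; set v := lam x.
  by move=> v1 v0 /andP[u0 u1]; apply/andP; split; nra.
have cl : continuous lam.
  apply: contM; first exact: cst_cont.
  apply: comp_cont (@depth_cont _ _ _ _ W).
  apply: comp_cont (@push_cont i).
  by apply: pair_cont; [exact: cst_cont|exact: id_cont].
have ct : continuous (fun tx : It * D => \val tx.1 : R).
  exact: (comp_cont (@fst_cont _ _) (@itv_val_cont R)).
have cw : continuous w.
  apply: contD; first by apply: contB => //; exact: cst_cont.
  by apply: contM => //; exact: comp_cont (@snd_cont _ _) cl.
exists (fun tx => push i (itv_clamp (w tx), tx.2)); split.
- apply: comp_cont (@push_cont i).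
  by apply: pair_cont; [exact: itv_clamp_cont|exact: snd_cont].
- move=> x; rewrite /w; cbn [fst snd].
  by rewrite [\val (itv_clamp 0)]itv_clamp0 // mul0r addr0 subr0 push1.
- move=> [t x]; apply: push_strat => /l_gt0 lx; rewrite itv_clampE //.
  rewrite /w; cbn [fst snd]; have := itvP t; have := l_le1 x; move: lx.
  by set u := \val t; set v := lam x; move=> v0 v1 /andP[u0 u1]; nra.
- move=> x; rewrite /w; cbn [fst snd]; rewrite [\val (itv_clamp 1)]itv_clamp1 //.
  rewrite subrr add0r mul1r; have [tail0|] := eqVneq (tail_mass i x) 0.
    rewrite push_tail0 //; apply: leW; have [j jx] := simplex_strat_exists x.
    rewrite jx flag_vertex_leE leqNgt; apply/negP => ij.
    have [xj _] := (simplex_strat_vertex x j).1 jx.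
    by rewrite (tail_mass_eq0 tail0 ij) ltxx in xj.
  rewrite neq_lt ltNge tail_mass_ge0 /= => /l_gt0 lx.
  apply: depthP; apply: le_lt_trans (push_dist _ _ _) _.
  by rewrite itv_clampE ?l_ge0 ?l_le1 //; rewrite /lam in lx *; lra.
Qed.

(** The vertices can be treated one after the other: precomposition with a further
    deformation keeps the image in the sets that are already reached. *)
Lemma shrink_into_vertices (s : seq 'I_(flag_dim I).+1) (W : _ -> set D) :
  (forall i x, simplex_strat x = flag_vertex i -> nbhs x (W i)) ->
  (forall i x, (simplex_strat x <= flag_vertex i)%O -> W i x) ->
  exists phi : It * D -> D, [/\ continuous phi,
    forall x, phi (itv_clamp 0, x) = x,
    forall tx, simplex_strat (phi tx) = simplex_strat tx.2 &
    forall i, i \in s -> forall x, W i (phi (itv_clamp 1, x))].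
Proof.
move=> nW leW; elim: s => [|i s [phi [cphi phi0 phis phiW]]].
  by exists snd; split => //; exact: snd_cont.
have cphi1 : continuous (fun x => phi (itv_clamp 1, x)).
  apply: comp_cont cphi.
  by apply: pair_cont; [exact: cst_cont|exact: id_cont].
have [|x ix|chi [cchi chi0 chis chiW]] :=
    @shrink_into_vertex i [set x | W i (phi (itv_clamp 1, x))].
- by move=> x ix; apply: cphi1; apply: nW; rewrite phis.
- by apply: leW; rewrite phis.
exists (fun tx => phi (tx.1, chi tx)); split.
- by apply: comp_cont cphi; apply: pair_cont => //; exact: fst_cont.
- by move=> x; rewrite /= phi0.
- by move=> tx; rewrite phis /= chis.
- move=> j; rewrite inE => /predU1P[-> x|js x]; first exact: chiW.
  exact: phiW.
Qed.

(** By compactness of the cube, one neighbourhood in the simplex works for all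
    parameters at once. *)
Lemma tube_stratum (k : space_kind) (X : strat_space R k P) (U : set X) m
    (f : @cube R m * D -> X) (p : P) :
  Delta_neighborhood (stratum_eq X p) U -> continuous f ->
  (forall qx, strat (f qx) = simplex_strat qx.2) ->
  forall x, simplex_strat x = p -> nbhs x [set x | forall q, U (f (q, x))].
Proof.
move=> pU cf sf x xp.
have /compact_near_coveringP/(_ _ (nbhs x) (fun y q => U (f (q, y)))
  (nbhs_filter x)) cover := @compact_cube R m.
have nU q : [set: @cube R m] q -> \forall q' \near q & y \near x, U (f (q', y)).
  move=> _; have := Delta_neighborhood_prism pU cf sf; move=> /(_ (q, x)).
  rewrite /= /stratum_eq /= sf => /(_ xp) [] // [A B] [Aq Bx] AB.
  by exists (A, B) => // -[q' y] ABq; exact: AB.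
have := cover nU; apply: filterS => y yU q; exact: yU.
Qed.

End Push.

(** * Spaces of maps out of a simplex *)

Section MappingSpaces.
Context (R : realType) (k : space_kind) (d : Order.disp_t) (P : porderType d).
Context (J : flag P).
Local Notation D := (simplex R J).
Local Notation It := (@unit_itv R).

Lemma compact_simplex : compact [set: D].
Proof. exact: compact_std_simplex. Qed.

Lemma regular_simplex : regular_space D.
Proof.
move=> x; apply: (compact_regular (@hausdorff_std_simplex R _) compact_simplex).
exact: filterT.
Qed.

Lemma locally_compact_simplex : locally_compact [set: D].
Proof.
move=> x _; exists [set: D]; first by rewrite withinET; exact: filterT.
by split; [exact: compact_simplex|exact: closedT].
Qed.

Lemma cube_retract_in_Top_prism Q : cube_retract R Q ->
  in_Top R k (Q * D : topologicalType)%type.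
Proof.
move=> [m [i [r [ci cr iK]]]].
apply: (@in_Top_retract _ _ _ (@cube R m * D)%type (fun qx => (i qx.1, qx.2))
  (fun qx => (r qx.1, qx.2))); last exact: in_Top_prism.
- by apply: pair_cont; [exact: comp_cont (@fst_cont _ _) ci|exact: snd_cont].
- by apply: pair_cont; [exact: comp_cont (@fst_cont _ _) cr|exact: snd_cont].
- by move=> [q x] /=; rewrite iK.
Qed.

Lemma cube_retract_in_Top Q : cube_retract R Q -> in_Top R k Q.
Proof.
move=> /cube_retract_in_Top_prism.
apply: (in_Top_retract (i := fun q => (q, last_vertex R J)) (r := fst)) => //.
- by apply: pair_cont; [exact: id_cont|exact: cst_cont].
- exact: fst_cont.
Qed.

Lemma simplex_in_Top : in_Top R k D.
Proof. exact: in_Top_std_simplex. Qed.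

Section Maps.
Context (X : topologicalType) (A : set {compact-open, D -> X}).

Definition maps_fun (s : core_space R k A) : D -> X := \val (s : set_type A).

Lemma maps_fun_inj : injective maps_fun.
Proof. exact: val_inj. Qed.

Lemma maps_funP s : A (maps_fun s).
Proof. exact: (set_valP s). Qed.

Definition maps_of (f : D -> X) (fA : A f) : core_space R k A :=
  exist (fun g => g \in A) f (mem_set fA).

Lemma maps_fun_continuous :
  continuous (maps_fun : _ -> {compact-open, D -> X}).
Proof.
apply/continuousP => U oU; apply: test_openW.
by have /continuousP := @initial_continuous A _ set_val; exact.
Qed.

Lemma maps_eval_continuous x : continuous (fun s => maps_fun s x).
Proof.
apply/continuousP => O oO; have /continuousP := maps_fun_continuous.
move=> /(_ _ (compact_open_open (@compact_set1 _ x) oO)).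
congr open; apply/seteqP; split=> s /=; last by move=> sO _ [_ -> <-].
by apply; exists x.
Qed.

Lemma maps_in_continuous (Z : topologicalType) (a : Z -> core_space R k A) :
  in_Top R k Z ->
  continuous ((fun z => maps_fun (a z)) : Z -> {compact-open, D -> X}) ->
  continuous a.
Proof.
move=> ZT ca; pose a' : Z -> A := a.
have ca' : continuous a' by exact: continuous_comp_initial.
exact: (@continuous_to_coreflection R k (Defs.Space Z ZT) _ a' ca').
Qed.

Lemma maps_uncurry (Q : topologicalType) (a : Q -> core_space R k A) :
  (forall s, A s -> continuous s) -> continuous a ->
  continuous (fun qx : Q * D => maps_fun (a qx.1) qx.2).
Proof.
move=> cA ca.
apply: (@eq_cont _ _ _ (uncurry (fun q => maps_fun (a q)))); first by case.
apply: continuous_uncurry_regular.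
- exact: locally_compact_simplex.
- exact: regular_simplex.
- exact: (comp_cont ca maps_fun_continuous).
- by move=> q; apply: cA; exact: maps_funP.
Qed.

(** Test spaces are in [Top] whatever its kind, so that the coreflected topology
    imposes no condition on maps out of them. *)
Lemma maps_curry (Q : topologicalType) (a : Q -> core_space R k A) :
  cube_retract R Q -> continuous (fun qx : Q * D => maps_fun (a qx.1) qx.2) ->
  continuous a.
Proof.
move=> cQ ca; apply: maps_in_continuous; first exact: cube_retract_in_Top.
exact: (continuous_curry_fun ca).
Qed.

End Maps.
End MappingSpaces.
Arguments maps_of {R k d P J X A f} fA.

Lemma cube_retract_itvX (R : realType) (Q : topologicalType) :
  cube_retract R Q -> cube_retract R (@unit_itv R * Q : topologicalType)%type.
Proof.
move=> [m [i [r [ci cr iK]]]]; have [l [j [s [cj cs jK]]]] := cube_retract_prism R m.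
exists l, (fun tq => j (tq.1, i tq.2)), (fun c => ((s c).1, r (s c).2)); split.
- apply: comp_cont cj; apply: pair_cont; first exact: fst_cont.
  exact: comp_cont (@snd_cont _ _) ci.
- apply: pair_cont; first exact: comp_cont cs (@fst_cont _ _).
  by apply: comp_cont cr; exact: comp_cont cs (@snd_cont _ _).
- by move=> [t q]; rewrite /= jK iK.
Qed.

Lemma compact_open_conj (S S' X X' : topologicalType) (g : S' -> S) (f : X -> X') :
  continuous g -> continuous f ->
  continuous ((fun s => f \o s \o g) :
    {compact-open, S -> X} -> {compact-open, S' -> X'}).
Proof.
move=> cg cf s; have FF := nbhs_filter s; apply/compact_open_cvgP => K O cK oO sKO.
have cgK : compact (g @` K).
  by apply: continuous_compact => //; exact: continuous_subspaceT.
have ofO : open (f @^-1` O) by have /continuousP := cf; exact.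
have oKO := compact_open_open cgK ofO.
apply: filterS (open_nbhs_nbhs (conj oKO _)).
  by move=> t tKO _ [x Kx <-]; apply: tKO; exists (g x) => //; exists x.
by move=> _ [_ [x Kx <-] <-]; apply: sKO; exists x.
Qed.

(** * Contractions of a simplex and dual cells *)

Section Slide.
Context (R : realType) (d : Order.disp_t) (P : porderType d) (J : flag P).
Local Notation D := (simplex R J).
Local Notation It := (@unit_itv R).

Definition slide_val (b : D) (tx : It * D) i : R :=
  (1 - \val tx.1) * barycentric b i + \val tx.1 * barycentric tx.2 i.

Lemma slide_valP b tx :
  (forall i, 0 <= slide_val b tx i) /\ \sum_i slide_val b tx i = 1.
Proof.
case: tx => t x; have /andP[t0 t1] := itvP t; split=> [i|].
  by rewrite addr_ge0 // mulr_ge0 ?subr_ge0 ?barycentric_ge0.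
by rewrite big_split /= -!mulr_sumr !barycentric_sum !mulr1 subrK.
Qed.

Definition slide b tx : D := simplex_of (slide_valP b tx).

Lemma slideE b tx i : barycentric (slide b tx) i = slide_val b tx i.
Proof. exact: simplex_ofE. Qed.

Lemma slide_cont b : continuous (slide b).
Proof.
apply: simplex_cont => i; apply: (eq_cont (fun tx => slideE b tx i)).
have ct : continuous (fun tx : It * D => \val tx.1 : R).
  exact: (comp_cont (@fst_cont _ _) (@itv_val_cont R)).
apply: contD; apply: contM => //; last by apply: barycentric_cont; exact: snd_cont.
- by apply: contB => //; exact: cst_cont.
- exact: cst_cont.
Qed.

Lemma slide0 b x : slide b (itv_clamp 0, x) = b.
Proof.
apply: barycentric_inj => i; rewrite slideE /slide_val; cbn [fst snd].
by rewrite itv_clamp0 // subr0 mul1r mul0r addr0.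
Qed.

Lemma slide1 b x : slide b (itv_clamp 1, x) = x.
Proof.
apply: barycentric_inj => i; rewrite slideE /slide_val; cbn [fst snd].
by rewrite itv_clamp1 // subrr mul0r mul1r add0r.
Qed.

Lemma barycenterP : (forall i : 'I_(flag_dim J).+1, 0 <= ((flag_dim J).+1%:R^-1 : R)) /\
  \sum_(i < (flag_dim J).+1) ((flag_dim J).+1%:R^-1 : R) = 1.
Proof.
split=> [_|]; first by rewrite invr_ge0 ler0n.
by rewrite sumr_const card_ord -[_ *+ _]mulr_natr mulVf // pnatr_eq0.
Qed.

Definition barycenter : D := simplex_of barycenterP.

(** The points where the coordinate [i] is maximal form the dual cell of the
    vertex [i] in the barycentric subdivision. *)
Definition dual_cell i : set D :=
  [set x | forall j, barycentric x j <= barycentric x i].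

Lemma dual_cell_gt0 i x : dual_cell i x -> 0 < barycentric x i.
Proof. by move=> ix; have [j xj] := barycentric_supp x; exact: lt_le_trans (ix j). Qed.

Lemma dual_cell_barycenter i : dual_cell i barycenter.
Proof. by move=> j; rewrite !simplex_ofE. Qed.

Lemma dual_cell_slide i t x :
  dual_cell i x -> dual_cell i (slide barycenter (t, x)).
Proof.
have /andP[t0 _] := itvP t.
move=> ix j; rewrite !slideE /slide_val /= !simplex_ofE lerD2l.
exact: ler_wpM2l.
Qed.

End Slide.

(** * The interpolating diagrams *)

Section Interpolation.
Context (R : realType) (k : space_kind) (d : Order.disp_t) (P : porderType d).
Implicit Types (I : regular_flag P) (X Y Z : nbhd_space R k P).

Lemma nbhd_flag_strat_mapP X Y I I' (sub : flag_incl I' I) (f : nbhd_map X Y) x :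
  strat (nbhd_flag_map sub f x) = strat x.
Proof. exact: strat_funP. Qed.

Definition nbhd_flag_strat_map X Y I I' (sub : flag_incl I' I) (f : nbhd_map X Y) :
  strat_map (nbhd_flag X I) (nbhd_flag Y I') :=
  StratMap (@nbhd_flag_strat_mapP X Y I I' sub f).

Definition flag_link X I : Defs.space R k := holink I (nbhd_flag X I).

Definition flag_link_map X Y I I' (sub : flag_incl I' I) (f : nbhd_map X Y) :
    continuousType (flag_link X I) (flag_link Y I') :=
  holink_post I' (nbhd_flag_strat_map sub f) \o holink_restr sub (nbhd_flag X I).

Definition flag_link_pt X I (s : flag_link X I) (x : simplex R I) : X :=
  subspace_val (holink_map s x).

Lemma flag_link_pt_inj X I (s t : flag_link X I) :
  flag_link_pt s =1 flag_link_pt t -> s = t.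
Proof.
move=> st; apply: holink_map_inj; apply/funext => x; apply: subspace_val_inj.
exact: st.
Qed.

Lemma flag_link_mapE X Y I I' (sub : flag_incl I' I) (f : nbhd_map X Y) s x :
  flag_link_pt (flag_link_map sub f s) x = f (flag_link_pt s (face sub x)).
Proof. by []. Qed.

Program Definition flag_link_diagram (X : nbhd_category R k P) :
    diagram_category R k P :=
  @Functor (opposite (sd_category P)) (top_category R k)
    (fun I => flag_link X I) (fun I I' sub => flag_link_map sub (idm X)) _ _.
Next Obligation.
move=> X I; apply/continuousEP => s; apply: flag_link_pt_inj => x.
by rewrite flag_link_mapE face_id.
Qed.
Next Obligation.
move=> X I I' I'' sub' sub; apply/continuousEP => s; apply: flag_link_pt_inj => x.
by rewrite flag_link_mapE (face_comp sub' sub).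
Qed.

Program Definition flag_link_functor :
    functor (nbhd_category R k P) (diagram_category R k P) :=
  @Functor (nbhd_category R k P) (diagram_category R k P) flag_link_diagram
    (fun X Y f => @NatTrans _ _ (flag_link_diagram X) (flag_link_diagram Y)
       (fun I => flag_link_map (fun p pI => pI) f) _) _ _.
Next Obligation.
move=> X Y f I I' sub; apply/continuousEP => s; apply: flag_link_pt_inj => x.
apply: etrans (congr1 (fun z => f (flag_link_pt s (face sub z))) (face_id _ x)) _.
exact/esym/(congr1 (fun z => f (flag_link_pt s z)))/face_id.
Qed.
Next Obligation.
move=> X; apply: nat_trans_eq => I; apply/continuousEP => s.
by apply: flag_link_pt_inj => x; rewrite flag_link_mapE face_id.
Qed.
Next Obligation.
move=> X Y Z g f; apply: nat_trans_eq => I; apply/continuousEP => s.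
apply: flag_link_pt_inj => x.
exact/esym/(congr1 (fun z => g (f (flag_link_pt s z))))/face_id.
Qed.

(** The maps that send the dual cell of each face of the simplex of [I] into the
    value of the diagram of neighbourhoods at that face. Both the dual cell of a
    face and this value are intersections over the vertices of the face, so that
    the condition is imposed on vertices. *)
Definition dual_maps X I : set {compact-open, simplex R I -> X} :=
  [set s | continuous s /\ forall x i, dual_cell i x ->
     nbhd X (flag_vertex i) (s x) /\ (flag_vertex i <= strat (s x))%O].
Arguments dual_maps X I : clear implicits.

Definition dual_link X I : Defs.space R k := core_space R k (dual_maps X I).

(** A dual cell of a face is the intersection of the face with a dual cell of the
    simplex. *)
Lemma dual_map_comp X Y I I' (sub : flag_incl I' I) (f : nbhd_map X Y)
    (s : dual_link X I) : dual_maps Y I' (f \o maps_fun s \o face sub).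
Proof.
have [cs sP] := maps_funP s; split.
  exact: (comp_cont (@face_continuous _ _ _ _ _ sub)
    (comp_cont cs (@cts_fun _ _ (nbhd_fun f)))).
move=> x i ix; have [j ji] := flag_mem_vertex (sub _ (flag_vertex_mem i)).
have faceE l i' : flag_vertex l = flag_vertex i' ->
    barycentric (face sub x) l = barycentric x i'.
  move=> li; rewrite barycentric_face li (big_pred1 i') // => m /=.
  by apply/eqP/eqP => [/flag_vertex_inj|->].
have [|sU sge] := sP (face sub x) j.
  move=> l; rewrite (faceE j i) //.
  have [[i' li]|nl] := pselect (exists i' : 'I_(flag_dim I').+1,
    flag_vertex l = flag_vertex i').
    by rewrite (faceE l i').
  rewrite barycentric_face big_pred0 ?barycentric_ge0 // => m.
  by apply/negbTE/eqP => ml; apply: nl; exists m.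
by rewrite -ji; split; [exact: nbhd_funP|rewrite /= strat_funP].
Qed.

Lemma dual_link_map_continuous X Y I I' (sub : flag_incl I' I) (f : nbhd_map X Y) :
  continuous (fun s : dual_link X I => maps_of (dual_map_comp sub f s) : dual_link Y I').
Proof.
apply: maps_in_continuous; first exact: spaceP.
exact: (comp_cont (@maps_fun_continuous _ _ _ _ I X (dual_maps X I))
  (compact_open_conj (@face_continuous _ _ _ _ _ sub)
    (@cts_fun _ _ (nbhd_fun f)))).
Qed.

Definition dual_link_map X Y I I' (sub : flag_incl I' I) (f : nbhd_map X Y) :
    continuousType (dual_link X I) (dual_link Y I') :=
  mkcts (@dual_link_map_continuous X Y I I' sub f).

Lemma dual_link_eq X I (s t : dual_link X I) : maps_fun s =1 maps_fun t -> s = t.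
Proof. by move=> st; apply: maps_fun_inj; exact/funext. Qed.

Lemma dual_link_mapE X Y I I' (sub : flag_incl I' I) (f : nbhd_map X Y) s x :
  maps_fun (dual_link_map sub f s) x = f (maps_fun s (face sub x)).
Proof. by []. Qed.

Program Definition dual_link_diagram (X : nbhd_category R k P) :
    diagram_category R k P :=
  @Functor (opposite (sd_category P)) (top_category R k)
    (fun I => dual_link X I) (fun I I' sub => dual_link_map sub (idm X)) _ _.
Next Obligation.
move=> X I; apply/continuousEP => s; apply: dual_link_eq => x.
by rewrite dual_link_mapE face_id.
Qed.
Next Obligation.
move=> X I I' I'' sub' sub; apply/continuousEP => s; apply: dual_link_eq => x.
by rewrite dual_link_mapE (face_comp sub' sub).
Qed.

Program Definition dual_link_functor :
    functor (nbhd_category R k P) (diagram_category R k P) :=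
  @Functor (nbhd_category R k P) (diagram_category R k P) dual_link_diagram
    (fun X Y f => @NatTrans _ _ (dual_link_diagram X) (dual_link_diagram Y)
       (fun I => dual_link_map (fun p pI => pI) f) _) _ _.
Next Obligation.
move=> X Y f I I' sub; apply/continuousEP => s; apply: dual_link_eq => x.
apply: etrans (congr1 (fun z => f (maps_fun s (face sub z))) (face_id _ x)) _.
exact/esym/(congr1 (fun z => f (maps_fun s z)))/face_id.
Qed.
Next Obligation.
move=> X; apply: nat_trans_eq => I; apply/continuousEP => s.
by apply: dual_link_eq => x; rewrite dual_link_mapE face_id.
Qed.
Next Obligation.
move=> X Y Z g f; apply: nat_trans_eq => I; apply/continuousEP => s.
apply: dual_link_eq => x.
exact/esym/(congr1 (fun z => g (f (maps_fun s z))))/face_id.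
Qed.

(** * Forgetting the neighbourhoods *)

Definition nbhd_flag_strat_incl X I : strat_map (nbhd_flag X I) X :=
  @StratMap R k d P (nbhd_flag X I) X (subspace_incl (nbhd_flag_set (X := X) I))
    (fun=> erefl).

Definition flag_link_holink X I : continuousType (flag_link X I) (holink I X) :=
  holink_post I (nbhd_flag_strat_incl X I).

Lemma flag_link_holinkE X I s x :
  holink_map (flag_link_holink X I s) x = flag_link_pt s x.
Proof. by []. Qed.

(** Subspaces carry a coreflected topology, so a map into one is continuous as soon
    as it is so into [X] provided that its domain is in [Top]. *)
Lemma flag_link_cont X I (Q : topologicalType) (a : Q -> flag_link X I) :
  cube_retract R Q ->
  continuous (fun qx : Q * simplex R I => flag_link_pt (a qx.1) qx.2) ->
  continuous a.
Proof.
move=> cQ ca; apply: (maps_curry cQ).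
pose W := Defs.Space _ (@cube_retract_in_Top_prism R k d P I Q cQ).
have aU (qx : W) : nbhd_flag_set (X := X) I (flag_link_pt (a qx.1) qx.2).
  exact: subspace_valP.
apply: eq_cont (@subspace_lift_continuous R k W X _ _ aU ca) => qx.
exact: subspace_val_inj.
Qed.

(** Precomposition with a deformation of the simplex over [P] keeps links in
    [nbhd_flag X I] inside of it, and a suitable one takes a whole family of links
    parametrized by a cube there. *)
Lemma flag_link_holink_equivalence X I :
  equivalence_criterion R (flag_link_holink X I).
Proof.
have holink_cont (Q : topologicalType) (a : Q -> holink I X) : continuous a ->
    continuous (fun qx : Q * simplex R I => holink_map (a qx.1) qx.2).
  by apply: maps_uncurry => s [].
apply: equivalence_criterion_compression.
- move=> s t st; apply: flag_link_pt_inj => x.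
  by rewrite -!flag_link_holinkE st.
- by move=> Q cQ a /holink_cont ca; exact: flag_link_cont.
move=> Q cQ a ca; have [m [i [r [ci cr iK]]]] := cQ.
pose f (qx : @cube R m * simplex R I) := holink_map (a (r qx.1)) qx.2.
have cf : continuous f by exact: holink_cont (comp_cont cr ca).
have sf qx : strat (f qx) = simplex_strat qx.2.
  exact: (holink_mapP (a (r qx.1))).2.
have [j x|j x xj q|phi [cphi phi0 phis phiW]] := @shrink_into_vertices R d P I
  (index_enum _) (fun j => [set x | forall q, nbhd X (flag_vertex j) (f (q, x))]).
- exact: tube_stratum (@nbhd_Delta _ _ _ _ X (flag_vertex j)) cf sf _.
- by apply: nbhd_le; rewrite /stratum_le /= sf.
have cphit t : continuous (fun x => phi (t, x)).
  by apply: comp_cont cphi; apply: pair_cont; [exact: cst_cont|exact: id_cont].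
have HP t (S : strat_space R k P) (s : holink I S) :
    simplex_map (fun x => holink_map s (phi (t, x))).
  have [cs ss] := holink_mapP s; split=> [|x]; first exact: comp_cont (cphit t) cs.
  by rewrite ss phis.
exists (fun t s => mk_holink (HP t X s)); split.
- move=> s; apply: holink_map_inj; apply/funext => x.
  by rewrite -[RHS](congr1 (holink_map s) (phi0 x)).
- move=> t s; exists (mk_holink (HP t _ s)) => //.
  by apply: holink_map_inj; exact/funext.
- move=> q.
  pose W := Defs.Space _ (@simplex_in_Top R k d P I).
  have [cH sH] := HP (itv_clamp 1) X (a q).
  have HU (x : W) : nbhd_flag_set (X := X) I (holink_map (a q) (phi (itv_clamp 1, x))).
    move=> p /flag_mem_vertex[j <-].
    by have := phiW j (mem_index_enum j) x (i q); rewrite /f /= iK.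
  have lP : simplex_map (J := I) (X := nbhd_flag X I)
      (@subspace_lift R k W X (nbhd_flag_set (X := X) I) _ HU).
    by split => //; exact: (@subspace_lift_continuous R k W X _ _ HU cH).
  exists (mk_holink lP) => //.
  by apply: holink_map_inj; apply/funext => x.
- apply: maps_curry; first exact: cube_retract_itvX.
  apply: (@comp_cont _ _ _
    (fun tqx : @unit_itv R * Q * simplex R I => (tqx.1.2, phi (tqx.1.1, tqx.2)))
    (fun qx => holink_map (a qx.1) qx.2)); last exact: holink_cont.
  apply: pair_cont; first exact: comp_cont (@fst_cont _ _) (@snd_cont _ _).
  apply: comp_cont cphi; apply: pair_cont; last exact: snd_cont.
  exact: comp_cont (@fst_cont _ _) (@fst_cont _ _).
Qed.

(** * Constant maps *)

Section Constants.
Context (X : nbhd_space R k P) (I : regular_flag P).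

Lemma nbhd_flag_ptP (y : nbhd_flag_ge X I) (i : 'I_(flag_dim I).+1) :
  nbhd X (flag_vertex i) (nbhd_flag_pt y) /\
  (flag_vertex i <= strat (nbhd_flag_pt y))%O.
Proof.
split; first exact: (subspace_valP (subspace_val y)) (flag_vertex_mem i).
apply: le_trans (subspace_valP y).
exact/flag_last_ge/flag_vertex_mem.
Qed.

Lemma dual_const_maps (y : nbhd_flag_ge X I) :
  dual_maps X I (fun=> nbhd_flag_pt y).
Proof. by split=> [|x i _]; [exact: cst_cont|exact: nbhd_flag_ptP]. Qed.

Lemma nbhd_flag_pt_continuous : continuous (@nbhd_flag_pt R k d P X I).
Proof.
exact: comp_cont (@subspace_val_continuous _ _ _ _)
  (@subspace_val_continuous _ _ _ _).
Qed.

Lemma dual_const_continuous : continuous (fun y => maps_of (dual_const_maps y) : dual_link X I).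
Proof.
apply: maps_in_continuous; first exact: spaceP.
apply: (@continuous_curry_fun _ _ _ (fun yx => nbhd_flag_pt yx.1)).
exact: comp_cont (@fst_cont _ _) nbhd_flag_pt_continuous.
Qed.

Definition dual_const : continuousType (nbhd_flag_ge X I) (dual_link X I) :=
  mkcts dual_const_continuous.

Let center : simplex R I := barycenter R I.

Lemma dual_centerP (s : dual_link X I) (i : 'I_(flag_dim I).+1) :
  nbhd X (flag_vertex i) (maps_fun s center) /\
  (flag_vertex i <= strat (maps_fun s center))%O.
Proof. by have [_] := maps_funP s; apply; exact: dual_cell_barycenter. Qed.

Lemma dual_center_flag (s : dual_link X I) :
  nbhd_flag_set (X := X) I (maps_fun s center).
Proof. by move=> p /flag_mem_vertex[i <-]; have [] := dual_centerP s i. Qed.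

Lemma dual_center_ge (s : dual_link X I) :
  stratum_ge (nbhd_flag X I) (flag_last I) (subspace_lift dual_center_flag s).
Proof.
by rewrite /stratum_ge /= -flag_vertex_max; have [] := dual_centerP s ord_max.
Qed.

Definition dual_center (s : dual_link X I) : nbhd_flag_ge X I :=
  subspace_lift dual_center_ge s.

Lemma dual_center_continuous : continuous dual_center.
Proof.
apply: subspace_lift_continuous; apply: subspace_lift_continuous.
exact: maps_eval_continuous.
Qed.

(** Sliding a point of a dual cell towards the barycenter keeps it in this cell, so
    that contracting the simplex to its barycenter deforms a dual link into a
    constant one. *)
Lemma dual_const_equivalence : equivalence_criterion R dual_const.
Proof.
have HP (t : @unit_itv R) (s : dual_link X I) :
    dual_maps X I (fun x => maps_fun s (slide center (t, x))).
  have [cs sP] := maps_funP s; split=> [|x i ix].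
    apply: comp_cont cs; apply: comp_cont (@slide_cont _ _ _ _ center).
    by apply: pair_cont; [exact: cst_cont|exact: id_cont].
  by apply: sP; exact: dual_cell_slide.
apply: (@equivalence_criterion_deformation R _ _ _ dual_center
  (fun t s => maps_of (HP t s) : dual_link X I)).
- exact: cts_fun.
- exact: dual_center_continuous.
- by move=> y; apply: nbhd_flag_pt_inj.
- move=> Q cQ a ca; apply: maps_curry; first exact: cube_retract_itvX.
  apply: (@comp_cont _ _ _ (fun tqx : @unit_itv R * Q * simplex R I =>
    (tqx.1.2, slide center (tqx.1.1, tqx.2)))
    (fun qx => maps_fun (a qx.1) qx.2)); last by apply: maps_uncurry ca => s [].
  apply: pair_cont; first exact: comp_cont (@fst_cont _ _) (@snd_cont _ _).
  apply: comp_cont (@slide_cont _ _ _ _ center); apply: pair_cont.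
    exact: comp_cont (@fst_cont _ _) (@fst_cont _ _).
  exact: snd_cont.
- move=> s; apply: dual_link_eq => x.
  exact: (congr1 (maps_fun s) (slide0 center x)).
- move=> s; apply: dual_link_eq => x.
  exact: (congr1 (maps_fun s) (slide1 center x)).
- by move=> t y; apply: dual_link_eq.
Qed.

(** * Including links into dual links *)

Lemma flag_link_dual_maps (s : flag_link X I) : dual_maps X I (flag_link_pt s).
Proof.
have [cs ss] := holink_mapP s; split=> [|x i ix].
  exact: comp_cont cs (@subspace_val_continuous _ _ _ _).
split; first exact: (subspace_valP (holink_map s x)) (flag_vertex_mem i).
have -> : strat (flag_link_pt s x) = simplex_strat x by exact: ss.
by have [_ xmax] := (simplex_stratP x _).1 erefl; apply: xmax; exact: dual_cell_gt0.
Qed.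

Lemma flag_link_dual_continuous :
  continuous (fun s => maps_of (flag_link_dual_maps s) : dual_link X I).
Proof.
apply: maps_in_continuous; first exact: spaceP.
exact: (comp_cont (@holink_map_continuous _ _ _ _ I (nbhd_flag X I))
  (compact_open_conj (@id_cont (simplex R I)) (@subspace_val_continuous _ _ _ _))).
Qed.

Definition flag_link_dual : continuousType (flag_link X I) (dual_link X I) :=
  mkcts flag_link_dual_continuous.

(** Contracting the simplex to its last vertex connects the inclusion with the
    evaluation at that vertex. The stratum jumps up only at the end of the
    contraction, which is why the homotopy leaves the links but stays in the dual
    links. *)
Lemma flag_link_dual_equivalence :
  weak_equivalence R (eval_last I (nbhd_flag X I)) ->
  weak_equivalence R (nbhd_flag_incl X I) ->
  equivalence_criterion R flag_link_dual.
Proof.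
move=> /weak_equivalenceP we /weak_equivalenceP wi.
pose v := last_vertex R I.
have HP (t : @unit_itv R) (s : flag_link X I) :
    dual_maps X I (fun x => flag_link_pt s (slide v (t, x))).
  have [cs ss] := holink_mapP s; split=> [|x i ix].
    apply: (comp_cont _ (flag_link_dual_maps s).1).
    apply: comp_cont (@slide_cont _ _ _ _ v).
    by apply: pair_cont; [exact: cst_cont|exact: id_cont].
  split; first exact: (subspace_valP (holink_map s _)) (flag_vertex_mem i).
  have -> : strat (flag_link_pt s (slide v (t, x))) =
    simplex_strat (slide v (t, x)) by exact: ss.
  have [tE|t0] := eqVneq (\val t) 0.
    rewrite (itv_eq0 tE) slide0 last_vertex_strat.
    exact/flag_last_ge/flag_vertex_mem.
  have [_ xmax] := (simplex_stratP (slide v (t, x)) _).1 erefl; apply: xmax.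
  have /andP[t0' t1] := itvP t.
  rewrite slideE /slide_val ltr_wpDl // ?mulr_ge0 ?subr_ge0 ?barycentric_ge0 //.
  by rewrite mulr_gt0 ?dual_cell_gt0 // lt0r t0.
pose H t s : dual_link X I := maps_of (HP t s).
have -> : (flag_link_dual : _ -> _) = H (itv_clamp 1).
  apply/funext => s; apply: dual_link_eq => x.
  exact: esym (congr1 (flag_link_pt s) (slide1 v x)).
apply: equivalence_criterion_homotopic.
  move=> Q cQ a ca; apply: maps_curry; first exact: cube_retract_itvX.
  apply: (@comp_cont _ _ _ (fun tqx : @unit_itv R * Q * simplex R I =>
    (tqx.1.2, slide v (tqx.1.1, tqx.2)))
    (fun qx => flag_link_pt (a qx.1) qx.2)).
    apply: pair_cont; first exact: comp_cont (@fst_cont _ _) (@snd_cont _ _).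
    apply: comp_cont (@slide_cont _ _ _ _ v); apply: pair_cont.
      exact: comp_cont (@fst_cont _ _) (@fst_cont _ _).
    exact: snd_cont.
  apply: (comp_cont _ (@subspace_val_continuous _ _ _ _)).
  by apply: maps_uncurry ca => s [].
have -> : H (itv_clamp 0) =
    dual_const \o (nbhd_flag_incl X I \o eval_last I (nbhd_flag X I)).
  apply/funext => s; apply: dual_link_eq => x.
  exact: (congr1 (flag_link_pt s) (slide0 v x)).
apply: equivalence_criterion_comp.
- exact: comp_cont (@cts_fun _ _ _) (@cts_fun _ _ _).
- exact: cts_fun.
- by apply: equivalence_criterion_comp => //; exact: cts_fun.
- exact: dual_const_equivalence.
Qed.

End Constants.

(** * The zigzag *)

Program Definition flag_link_to_holink :
    nat_trans (functor_comp flag_link_functor (homod_incl R k P))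
      (functor_comp (holink_functor R k P) (homod_forget R k P)) :=
  @NatTrans _ _ (functor_comp flag_link_functor (homod_incl R k P))
      (functor_comp (holink_functor R k P) (homod_forget R k P))
    (fun A => @NatTrans _ _ (flag_link_diagram (sval A)) (holink_diagram (nbhd_strat (sval A)))
       (fun I => flag_link_holink (sval A) I) _) _.
Next Obligation.
move=> A I I' sub; apply/continuousEP => s; apply: holink_map_inj.
by apply/funext.
Qed.
Next Obligation.
move=> A B f; apply: nat_trans_eq => I; apply/continuousEP => s.
by apply: holink_map_inj; apply/funext => x; rewrite /= flag_link_holinkE
  flag_link_mapE face_id.
Qed.

Program Definition flag_link_to_dual :
    nat_trans (functor_comp flag_link_functor (homod_incl R k P))
      (functor_comp dual_link_functor (homod_incl R k P)) :=
  @NatTrans _ _ (functor_comp flag_link_functor (homod_incl R k P))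
      (functor_comp dual_link_functor (homod_incl R k P))
    (fun A => @NatTrans _ _ (flag_link_diagram (sval A)) (dual_link_diagram (sval A))
       (fun I => flag_link_dual (sval A) I) _) _.
Next Obligation.
by move=> A I I' sub; apply/continuousEP => s; exact: dual_link_eq.
Qed.
Next Obligation.
move=> A B f; apply: nat_trans_eq => I; apply/continuousEP => s.
exact: dual_link_eq.
Qed.

Program Definition DT_to_dual :
    nat_trans (functor_comp (DT_functor R k P) (homod_incl R k P))
      (functor_comp dual_link_functor (homod_incl R k P)) :=
  @NatTrans _ _ (functor_comp (DT_functor R k P) (homod_incl R k P))
      (functor_comp dual_link_functor (homod_incl R k P))
    (fun A => @NatTrans _ _ (DT_diagram (sval A)) (dual_link_diagram (sval A))
       (fun I => dual_const (sval A) I) _) _.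
Next Obligation.
by move=> A I I' sub; apply/continuousEP => s; exact: dual_link_eq.
Qed.
Next Obligation.
move=> A B f; apply: nat_trans_eq => I; apply/continuousEP => s.
exact: dual_link_eq.
Qed.

End Interpolation.

Theorem theorem1p4p14 (R : realType) (k : space_kind) (d : Order.disp_t)
    (P : porderType d) :
  weakly_equivalent
    (functor_comp (holink_functor R k P) (homod_forget R k P))
    (functor_comp (DT_functor R k P) (homod_incl R k P)).
Proof.
pose C := functor_category (homod_category R k P) (diagram_category R k P).
pose F : C := functor_comp (flag_link_functor R k P) (homod_incl R k P).
pose E : C := functor_comp (dual_link_functor R k P) (homod_incl R k P).
apply: (@zigzag_backward C _ _ F _ (flag_link_to_holink R k P)).
  by move=> A I; apply/weak_equivalenceP; exact: flag_link_holink_equivalence.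
apply: (@zigzag_forward C _ F E _ (flag_link_to_dual R k P)).
  move=> A I; apply/weak_equivalenceP; have [we wi] := svalP A I.
  exact: flag_link_dual_equivalence.
apply: (@zigzag_backward C _ E _ _ (DT_to_dual R k P)).
  by move=> A I; apply/weak_equivalenceP; exact: dual_const_equivalence.
exact: zigzag_refl.
Qed.
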